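(* Let $C$ be a commutative ring and let $\mathcal{F}$ be an elementary class of $C$-fields. The following are equivalent: (a) The valuation ring is uniformly $\forall$-$C$-definable in $\mathcal{H}'(\mathcal{F})$. (b) The valuation ring is uniformly $\forall$-$C$-definable in $\mathcal{H}(\mathcal{F})$. (c) $\mathcal{F}$ is not large. Moreover, the following are also equivalent: (a') The valuation ring is uniformly $\forall$-$C$-definable in $\mathcal{H}'_e(\mathcal{F})$. (b') The valuation ring is uniformly $\forall$-$C$-definable in $\mathcal{H}_e(\mathcal{F})$. (c') $\mathcal{F}$ is not equicharacteristic large.
   Context: A $C$-field is a field with a fixed ring homomorphism $C\to F$; embeddings and isomorphisms commute with these homomorphisms; all valuations are nonnegative on the image of $C$, and residue fields are $C$-fields via the residue map. $\mathcal{L}_{\mathrm{ring}}(C)$ is the ring language with constants for elements of $C$; an elementary class of $C$-fields is one axiomatized by $\mathcal{L}_{\mathrm{ring}}(C)$-sentences. A valuation $v$ on $K$ is equicharacteristic if $\mathrm{char}(K)=\mathrm{char}(Kv)$. $\mathcal{H}(\mathcal{F})$ is the class of henselian valued $C$-fields $(K,v)$ with $Kv\in\mathcal{F}$ (trivial valuations allowed); $\mathcal{H}'(\mathcal{F})$ its subclass with $v$ nontrivial; $\mathcal{H}_e(\mathcal{F})$, $\mathcal{H}'_e(\mathcal{F})$ the respective subclasses with $v$ equicharacteristic. The valuation ring is uniformly $\forall$-$C$-definable in a class $\mathcal{K}$ if there is one universal $\mathcal{L}_{\mathrm{ring}}(C)$-formula $\phi(x)$ with $\phi(K)=\mathcal{O}_v$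 for all $(K,v)\in\mathcal{K}$. $\mathcal{F}$ is [equicharacteristic] large if there exist $F_1,F_2\in\mathcal{F}$, a $C$-subfield $E\subseteq F_2$ and a nontrivial [equicharacteristic] henselian valuation $w$ on $E$ with $Ew\cong F_1$ as $C$-fields. *)

(* Defs.v *)
From HB Require Import structures.
From mathcomp Require Import all_boot all_order all_algebra.

Set Implicit Arguments.
Unset Strict Implicit.
Unset Printing Implicit Defensive.

Import Order.TTheory GRing.Theory Num.Theory.
Local Open Scope ring_scope.
Local Open Scope quotient_scope.

Record Cfield (C : comPzRingType) := MkCfield {
  Cfield_sort :> fieldType;
  Cmap : {rmorphism C -> Cfield_sort}
}.

Definition Ciso (C : comPzRingType) (K L : Cfield C) : Prop :=
  exists f : {rmorphism K -> L},
    bijective f /\ (forall c : C, f (Cmap K c) = Cmap L c).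

(* The library's GRing.term and GRing.formula also have the inverse and the unit
   predicate, so the language of rings with constants from C is set up here. *)
Section Formulas.
Variable C : comPzRingType.

Inductive Lterm : Type :=
| LVar of nat
| LConst of C
| LZero
| LOne
| LAdd of Lterm & Lterm
| LOpp of Lterm
| LMul of Lterm & Lterm.

Inductive Lformula : Type :=
| LEqual of Lterm & Lterm
| LNot of Lformula
| LAnd of Lformula & Lformula
| LOr of Lformula & Lformula
| LExists of nat & Lformula
| LForall of nat & Lformula.

Fixpoint term_fv (t : Lterm) : seq nat :=
  match t with
  | LVar i => [:: i]
  | LConst _ | LZero | LOne => [::]
  | LOpp t1 => term_fv t1
  | LAdd t1 t2 | LMul t1 t2 => term_fv t1 ++ term_fv t2
  end.

Fixpoint formula_fv (f : Lformula) : seq nat :=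
  match f with
  | LEqual t1 t2 => term_fv t1 ++ term_fv t2
  | LNot f1 => formula_fv f1
  | LAnd f1 f2 | LOr f1 f2 => formula_fv f1 ++ formula_fv f2
  | LExists i f1 | LForall i f1 => [seq j <- formula_fv f1 | j != i]
  end.

Fixpoint quantifier_free (f : Lformula) : bool :=
  match f with
  | LEqual _ _ => true
  | LNot f1 => quantifier_free f1
  | LAnd f1 f2 | LOr f1 f2 => quantifier_free f1 && quantifier_free f2
  | LExists _ _ | LForall _ _ => false
  end.

Definition universal (f : Lformula) : Prop :=
  exists (xs : seq nat) (g : Lformula),
    quantifier_free g /\ f = foldr LForall g xs.

Section Semantics.
Variable K : Cfield C.

Fixpoint term_eval (e : nat -> K) (t : Lterm) : K :=
  match t with
  | LVar i => e i
  | LConst c => Cmap K c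
  | LZero => 0
  | LOne => 1
  | LAdd t1 t2 => term_eval e t1 + term_eval e t2
  | LOpp t1 => - term_eval e t1
  | LMul t1 t2 => term_eval e t1 * term_eval e t2
  end.

Definition update (e : nat -> K) (i : nat) (x : K) : nat -> K :=
  fun j => if j == i then x else e j.

Fixpoint holds (e : nat -> K) (f : Lformula) : Prop :=
  match f with
  | LEqual t1 t2 => term_eval e t1 = term_eval e t2
  | LNot f1 => ~ holds e f1
  | LAnd f1 f2 => holds e f1 /\ holds e f2
  | LOr f1 f2 => holds e f1 \/ holds e f2
  | LExists i f1 => exists x : K, holds (update e i x) f1
  | LForall i f1 => forall x : K, holds (update e i x) f1
  end.

End Semantics.

Definition sentence (f : Lformula) : Prop := formula_fv f = [::].

Definition models (K : Cfield C) (f : Lformula) : Prop := holds (fun=> 0 : K) f.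

(* phi(x) is a formula whose only free variable, if any, is variable 0. *)
Definition unary_formula (f : Lformula) : Prop :=
  {subset formula_fv f <= [:: 0%N]}.

Definition satisfies (K : Cfield C) (f : Lformula) (a : K) : Prop :=
  holds (fun=> a) f.

Definition elementary_class (F : Cfield C -> Prop) : Prop :=
  exists T : Lformula -> Prop,
    (forall f, T f -> sentence f) /\
    (forall K : Cfield C, F K <-> (forall f, T f -> models K f)).

End Formulas.

(* The value set Gamma u {oo} is option Gamma, with None for oo. *)
Section ValueSet.
Variable G : porderZmodType.
Implicit Types a b : option G.

Definition evadd a b : option G :=
  match a, b with Some x, Some y => Some (x + y) | _, _ => None end.

Definition evle a b : bool :=
  match a, b with
  | _, None => true
  | None, Some _ => false
  | Some x, Some y => x <= y
  end.

Definition evmin a b : option G := if evle a b then a else b.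

End ValueSet.

(* porderZmodType does not relate the order to the addition: the first two
   axioms make vgroup a totally ordered abelian group. The function v need not
   map onto vgroup, whose elements outside the image of v play no role. *)
Record valuation (C : comPzRingType) (K : Cfield C) := Valuation {
  vgroup : porderZmodType;
  vgroup_total : total (<=%R : rel vgroup);
  vgroup_leD2r : forall c a b : vgroup, a <= b -> a + c <= b + c;
  vfun :> K -> option vgroup;
  v_eqoo : forall x, vfun x = None <-> x = 0;
  v_M : forall x y, vfun (x * y) = evadd (vfun x) (vfun y);
  v_D : forall x y, evle (evmin (vfun x) (vfun y)) (vfun (x + y));
  v_C : forall c : C, evle (Some 0) (vfun (Cmap K c))
}.

Section Valuations.
Variables (C : comPzRingType) (K : Cfield C) (v : valuation K).

Definition valring : {pred K} := [pred x | evle (Some 0) (v x)].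

Definition valmax : {pred K} := [pred x | ~~ evle (v x) (Some 0)].

Definition nontrivial_val : Prop := exists x : K, x != 0 /\ v x <> Some 0.

Definition henselian : Prop :=
  forall (p : {poly K}) (a : K),
    p \is a polyOver valring -> a \in valring ->
    p.[a] \in valmax -> p^`().[a] \notin valmax ->
  exists b : K, [/\ b \in valring, root p b & b - a \in valmax].

Local Notation le := (@evle (vgroup v)).

Fact evle_refl a : le a a. Proof. by case: a => [x|] /=. Qed.

Fact evle_trans b a c : le a b -> le b c -> le a c.
Proof. by case: a b c => [x|] [y|] [z|] //=; apply: le_trans. Qed.

Fact evle_total a b : le a b || le b a.
Proof. by case: a b => [x|] [y|] //=; apply: vgroup_total. Qed.

Fact evle_min c a b : le c a -> le c b -> le c (evmin a b).
Proof. by rewrite /evmin; case: ifP. Qed.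

Fact evltW a b : ~~ le b a -> le a b.
Proof. by case/orP: (evle_total a b) => // ->. Qed.

Fact v_0 : v 0 = None. Proof. exact/v_eqoo. Qed.

Fact v_Some x : x != 0 -> exists g, v x = Some g.
Proof.
move=> x0; case E: (v x) => [g|]; first by exists g.
by move/eqP: x0; case; apply/(v_eqoo v x).
Qed.

Fact v_1 : v 1 = Some 0.
Proof.
have [g vg] := v_Some (oner_neq0 K).
have := v_M v 1 1; rewrite mulr1 vg /= => -[] /esym/eqP.
by rewrite -{3}[g]addr0 (inj_eq (addrI g)) => /eqP ->.
Qed.

Fact v_N1 : v (-1) = Some 0.
Proof.
have [g vg] : exists g, v (-1) = Some g by apply: v_Some; rewrite oppr_eq0 oner_eq0.
have := v_M v (-1) (-1); rewrite mulrNN mulr1 v_1 vg /= => -[] gg.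
congr Some.
have vgg : -g = g by apply/esym/eqP; rewrite -addr_eq0 -gg.
have key a : 0 <= a -> a + a = 0 :> vgroup v -> a = 0.
  move=> a0 aa; apply/eqP; rewrite eq_le a0 andbT -aa.
  by have := vgroup_leD2r a a0; rewrite add0r.
case/orP: (vgroup_total 0 g) => [g0|g0]; first exact: key.
apply: oppr_inj; rewrite oppr0; apply: key; last by rewrite vgg -gg.
by have := vgroup_leD2r (- g) g0; rewrite subrr add0r.
Qed.

Fact v_N x : v (- x) = v x.
Proof. by rewrite -mulN1r v_M v_N1; case: (v x) => //= g; rewrite add0r. Qed.

Fact valring_subring : subring_closed valring.
Proof.
split=> [|x y|x y]; rewrite !inE.
- by rewrite v_1 /=.
- move=> x0 y0; apply: evle_trans (v_D v x (- y)).
  by apply: evle_min; rewrite ?v_N.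
- rewrite v_M; case: (v x) => [a|] //; case: (v y) => [b|] //= a0 b0.
  by apply: le_trans b0 _; have := vgroup_leD2r b a0; rewrite add0r.
Qed.

HB.instance Definition _ := GRing.isSubringClosed.Build K valring valring_subring.

Record valring_type := ValringElt { valring_val : K; _ : valring_val \in valring }.
HB.instance Definition _ := [isSub for valring_val].
HB.instance Definition _ := [Choice of valring_type by <:].
HB.instance Definition _ := [SubChoice_isSubComNzRing of valring_type by <:].

Definition valideal : {pred valring_type} := [pred x | \val x \in valmax].

Fact valideal_closed : idealr_closed valideal.
Proof.
split=> [||a x y]; rewrite ?inE /=.
- by rewrite v_0.
- by rewrite v_1 /= lexx.
- have a0 : \val a \in valring by case: a.
  have vlt (b c : option (vgroup v)) : le (Some 0) b -> ~~ le c (Some 0) ->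
      ~~ le (evadd b c) (Some 0).
    case: b c => [b|] [c|] //= b0; apply: contra => /(le_trans _); apply.
    by have := vgroup_leD2r c b0; rewrite add0r.
  move: a0; rewrite !inE => a0 x0 y0.
  have ax0 : ~~ le (v (\val a * \val x)) (Some 0) by rewrite v_M vlt.
  apply: contra (evle_trans (v_D v (\val a * \val x) (\val y))) _.
  by rewrite /evmin; case: ifP.
Qed.

HB.instance Definition _ := isIdealr.Build valring_type valideal valideal_closed.

Definition residue : Type := {ideal_quot valideal}.
HB.instance Definition _ := GRing.ComNzRing.on residue.
HB.instance Definition _ := EqQuotient.on residue.

Definition res : valring_type -> residue := \pi_residue.

Fact res_zmod_morphism : zmod_morphism res.
Proof. by move=> x y; rewrite /res !piE. Qed.
Fact res_monoid_morphism : monoid_morphism res.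
Proof. by split=> [|x y]; rewrite /res !piE. Qed.
HB.instance Definition _ :=
  GRing.isZmodMorphism.Build valring_type residue res res_zmod_morphism.
HB.instance Definition _ :=
  GRing.isMonoidMorphism.Build valring_type residue res res_monoid_morphism.

Fact res_eq0 x : (res x == 0) = (\val x \in valmax).
Proof. by rewrite /res piE Quotient.equivE subr0. Qed.

Fact valring_inv x : x \notin valmax -> x^-1 \in valring.
Proof.
rewrite !inE negbK => vx; have [->|x0] := eqVneq x 0; first by rewrite invr0 v_0.
have := v_M v x x^-1; rewrite divff // v_1.
case: (v x) (v x^-1) vx => [a|] [b|] //= a0 [ab].
by rewrite ab; have := vgroup_leD2r b a0; rewrite add0r.
Qed.

Definition residue_inv (x : residue) : residue :=
  res (insubd 0 (\val (repr x))^-1).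

Fact residue_mulVf x : x != 0 -> residue_inv x * x = 1.
Proof.
rewrite /residue_inv -{1 3}[x]reprK; set z := repr x; rewrite -/(res z) res_eq0.
move=> z0; rewrite -rmorphM -(rmorph1 res); congr res; apply: val_inj.
have z'0 : valring_val z != 0 by apply: contraNneq z0 => /= ->; rewrite inE v_0.
have /= uE := insubdK (0 : valring_type) (valring_inv z0).
by rewrite /= uE mulVf.
Qed.

Fact residue_inv0 : residue_inv 0 = 0.
Proof.
rewrite /residue_inv; set z := repr 0.
have z0 : \val z \in valmax by rewrite -res_eq0 /res /z reprK.
apply/eqP; rewrite res_eq0 val_insubd; case: ifP => [zi|_]; last by rewrite raddf0 inE v_0.
move: z0 zi; rewrite !inE; have [->|y0] := eqVneq (\val z) 0.
  by rewrite invr0 v_0.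
have := v_M v (\val z) (\val z)^-1; rewrite divff // v_1.
case: (v (\val z)) (v (\val z)^-1) => [a|] [b|] //= [ab] a0 b0; case/negP: a0.
by rewrite ab; have := vgroup_leD2r a b0; rewrite add0r addrC.
Qed.

HB.instance Definition _ :=
  GRing.ComNzRing_isField.Build residue residue_mulVf residue_inv0.

Definition Cmap_valring (c : C) : valring_type := ValringElt (v_C v c).

Definition residue_Cmap (c : C) : residue := res (Cmap_valring c).

Fact residue_Cmap_zmod_morphism : zmod_morphism residue_Cmap.
Proof.
move=> c d; rewrite /residue_Cmap -rmorphB; congr res; apply: val_inj.
by rewrite rmorphB /= rmorphB.
Qed.
Fact residue_Cmap_monoid_morphism : monoid_morphism residue_Cmap.
Proof.
rewrite /residue_Cmap; split=> [|c d].
  by rewrite -(rmorph1 res); congr res; apply: val_inj; rewrite /= rmorph1.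
by rewrite -rmorphM; congr res; apply: val_inj; rewrite /= rmorphM.
Qed.
HB.instance Definition _ :=
  GRing.isZmodMorphism.Build C residue residue_Cmap residue_Cmap_zmod_morphism.
HB.instance Definition _ := GRing.isMonoidMorphism.Build C residue residue_Cmap
  residue_Cmap_monoid_morphism.

Definition residue_Cfield : Cfield C :=
  @MkCfield C residue residue_Cmap.

Definition equichar : Prop := [pchar K] =i [pchar residue].

End Valuations.

Section Subfields.
Variables (C : comPzRingType) (L : Cfield C).

Record Csubfield := MkCsubfield {
  Csubfield_pred :> {pred L};
  Csubfield_divring : divring_closed Csubfield_pred;
  Csubfield_C : forall c : C, Cmap L c \in Csubfield_pred
}.

Variable E : Csubfield.

HB.instance Definition _ :=
  GRing.isDivringClosed.Build L (Csubfield_pred E) (Csubfield_divring E).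

Record subfield_type :=
  SubfieldElt { subfield_val : L; _ : subfield_val \in Csubfield_pred E }.
HB.instance Definition _ := [isSub for subfield_val].
HB.instance Definition _ := [Choice of subfield_type by <:].
HB.instance Definition _ := [SubChoice_isSubIntegralDomain of subfield_type by <:].
HB.instance Definition _ := [SubIntegralDomain_isSubField of subfield_type by <:].

Definition subfield_Cmap (c : C) : subfield_type := SubfieldElt (Csubfield_C E c).

Fact subfield_Cmap_zmod_morphism : zmod_morphism subfield_Cmap.
Proof. by move=> c d; apply: val_inj; rewrite rmorphB /= rmorphB. Qed.
Fact subfield_Cmap_monoid_morphism : monoid_morphism subfield_Cmap.
Proof.
split=> [|c d]; apply: val_inj; first by rewrite rmorph1 /= rmorph1.
by rewrite rmorphM /= rmorphM.
Qed.
HB.instance Definition _ := GRing.isZmodMorphism.Build C subfield_type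
  subfield_Cmap subfield_Cmap_zmod_morphism.
HB.instance Definition _ := GRing.isMonoidMorphism.Build C subfield_type
  subfield_Cmap subfield_Cmap_monoid_morphism.

Definition subfield_Cfield : Cfield C :=
  @MkCfield C subfield_type subfield_Cmap.

End Subfields.

Section Main.
Variable C : comPzRingType.

Definition valued_class := forall K : Cfield C, valuation K -> Prop.

Definition uniformly_forall_definable (V : valued_class) : Prop :=
  exists phi : Lformula C,
    [/\ universal phi, unary_formula phi &
        forall (K : Cfield C) (v : valuation K), V K v ->
          forall a : K, satisfies phi a <-> a \in valring v].

Variable F : Cfield C -> Prop.

Definition H_class : valued_class :=
  fun K v => henselian v /\ F (residue_Cfield v).

Definition H'_class : valued_class :=
  fun K v => H_class v /\ nontrivial_val v.

Definition He_class : valued_class :=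
  fun K v => H_class v /\ equichar v.

Definition He'_class : valued_class :=
  fun K v => H'_class v /\ equichar v.

Definition large : Prop :=
  exists F1 F2 : Cfield C, [/\ F F1, F F2 &
    exists (E : Csubfield F2) (w : valuation (subfield_Cfield E)),
      [/\ nontrivial_val w, henselian w & Ciso (residue_Cfield w) F1]].

Definition equichar_large : Prop :=
  exists F1 F2 : Cfield C, [/\ F F1, F F2 &
    exists (E : Csubfield F2) (w : valuation (subfield_Cfield E)),
      [/\ nontrivial_val w, equichar w, henselian w &
          Ciso (residue_Cfield w) F1]].

End Main.

(* Main.v *)
(** The valuation ring is uniformly forall-definable in a class closed under ultraproducts as soon
    as every embedding f : K -> L of members (K, v), (L, w) satisfies f^-1(O_w) <= O_v; this is
    Prestel's criterion, proved by two ultraproducts (one over the universal formulas valid on all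
    valuation rings of the class, one over the finite parts of the diagram of K).

    Suppose that it fails, let a lie in f^-1(O_w) but not in O_v, and let u be the restriction of w
    to K. If u is coarser than v, then v induces a henselian valuation with residue field Kv on Ku,
    a subfield of Lw, so F is large. Otherwise u and v are incomparable, and lifting a polynomial
    over Ku to one which is close to X^(n-1) (X - 1) for v shows, by Hensel's lemma for v, that Ku is
    algebraically closed. Finitely generated subalgebras of (Lw)((t)) then map to Ku, so (Lw)((t))
    embeds into an ultrapower of Lw, and F is large again.

    Conversely, let E be a henselian subfield of F2 as in the definition of largeness. A universal
    formula that holds on the valuation ring of F2((t)), which contains E, holds on all of E, so it
    does not define the nontrivial valuation ring of E. *)

Require Import Defs.
From HB Require Import structures.
From mathcomp Require Import all_boot all_order all_algebra.
From mathcomp Require Import boolp classical_sets filter.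
From mathcomp Require Import ring.

Set Implicit Arguments.
Unset Strict Implicit.
Unset Printing Implicit Defensive.

Import Order.TTheory GRing.Theory.
Local Open Scope ring_scope.
Local Open Scope quotient_scope.

(** * Valuations and valuation rings *)

(** The formulas of the theorem speak of the field alone, so closure of the valued classes under
    ultraproducts is proved by hand: Hensel's lemma coordinate by coordinate, and Los's theorem only
    for the residue fields, where [F] is elementary. Los's theorem and the invariance of [F] under
    isomorphism are stated for relations, because residue fields and ultraproducts are quotients and
    most comparison maps exist only through representatives. In the incomparable case Hensel's lemma
    is applied to v; w enters through the embedding of Ku into Lw. A finitely generated subalgebra
    of (Lw)((t)) has a point in the algebraically closed field Ku by a Nullstellensatz argument, and
    the point respects C because C has the same kernel in both fields. The t-adic valuation is
    always equicharacteristic, so this case serves both versions of the theorem; only the coarser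
    case has to carry the equicharacteristic condition along. The implication from (c) to (b) treats
    trivial valuations from the start, while the one from (a) to (c) meets nontrivial ones only. *)

Section ValuationRing.
Variables (C : comPzRingType) (K : Cfield C) (v : valuation K).
Implicit Types x y : K.

Lemma valring1 : 1 \in valring v. Proof. exact: rpred1. Qed.

Lemma valring_C c : Cmap K c \in valring v. Proof. by rewrite inE v_C. Qed.

Lemma valmaxW x : x \in valmax v -> x \in valring v.
Proof. by rewrite !inE; apply: evltW. Qed.

Lemma valring_total x : x \in valring v \/ x^-1 \in valring v.
Proof.
have [/valmaxW|/valring_inv] := boolP (x \in valmax v); first by left.
by right.
Qed.

(** The maximal ideal is expressed through the valuation ring alone, which is how a valuation built
    by [valuation_of_ring] is known. *)
Lemma valmaxE x : (x \in valmax v) = (x == 0) || (x^-1 \notin valring v).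
Proof.
have [->|x0] /= := eqVneq x 0; first by rewrite inE v_0.
have := v_M v x x^-1; rewrite divff // v_1 !inE.
case: (v x) (v x^-1) => [a|] [b|] //= [ab].
congr negb; apply/idP/idP => h.
  by rewrite ab; have := vgroup_leD2r b h; rewrite add0r.
by rewrite ab; have := vgroup_leD2r a h; rewrite add0r addrC.
Qed.

Lemma valmax0 : 0 \in valmax v. Proof. by rewrite valmaxE eqxx. Qed.

Lemma valmax1 : 1 \notin valmax v.
Proof. by rewrite valmaxE oner_eq0 invr1 valring1. Qed.

Lemma valmaxD x y : x \in valmax v -> y \in valmax v -> x + y \in valmax v.
Proof.
rewrite !inE => hx hy; apply: contra (evle_trans (v_D v x y)) _.
by rewrite /evmin; case: ifP.
Qed.

Lemma valmaxM x y : x \in valring v -> y \in valmax v -> x * y \in valmax v.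
Proof.
rewrite !inE v_M; case: (v x) (v y) => [a|] [b|] //= a0.
by apply: contra => /(le_trans _); apply; have := vgroup_leD2r b a0; rewrite add0r.
Qed.

Lemma valmaxN x : x \in valmax v -> - x \in valmax v.
Proof. by move=> vx; rewrite -mulN1r valmaxM // rpredN valring1. Qed.

Lemma valmaxB x y : x \in valmax v -> y \in valmax v -> x - y \in valmax v.
Proof. by move=> vx /valmaxN; apply: valmaxD. Qed.

Lemma valmax_sum (I : Type) (r : seq I) (P : pred I) (f : I -> K) :
  (forall i, P i -> f i \in valmax v) -> \sum_(i <- r | P i) f i \in valmax v.
Proof. by move=> h; elim/big_ind: _ => //; [exact: valmax0|exact: valmaxD]. Qed.

Lemma horner_valmax (p : {poly K}) x :
  (forall i, p`_i \in valmax v) -> x \in valring v -> p.[x] \in valmax v.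
Proof.
move=> hp vx; rewrite horner_coef; apply: valmax_sum => i _.
by rewrite mulrC valmaxM // rpredX.
Qed.

Lemma nontrivialP : nontrivial_val v <-> exists x, x \notin valring v.
Proof.
split=> [[x [x0 vx]]|[x vx]]; last first.
  exists x; split; first by apply: contraNneq vx => ->; exact: rpred0.
  by move=> h; case/negP: vx; rewrite inE h /=.
case: (boolP (x \in valring v)) => [xr|]; last by exists x.
exists x^-1; move: vx xr; have := valmaxE x; rewrite (negPf x0) /= => <-.
rewrite !inE; case: (v x) => //= a h a0.
by apply: contra_notN h => a1; congr Some; apply/eqP; rewrite eq_le a0 a1.
Qed.

Lemma pchar_residue (p : nat) :
  (p \in [pchar (residue v)]) = prime p && ((p%:R : K) \in valmax v).
Proof.
rewrite inE; congr (_ && _).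
by rewrite -(rmorph1 (@res _ _ v)) -raddfMn /= res_eq0 raddfMn.
Qed.

Lemma equicharP :
  equichar v <-> forall p : nat, prime p -> (p%:R : K) \in valmax v -> p%:R = 0 :> K.
Proof.
split=> [h p pp pm|h p].
  by have := h p; rewrite pchar_residue pp pm /= inE => /andP[_ /eqP].
rewrite pchar_residue inE; case pp: (prime p) => //=.
by apply/eqP/idP => [->|]; [exact: valmax0|exact: h].
Qed.

(* An element x with x^-1 in the maximal ideal cannot be integral: divide the equation by x^n. *)
Lemma monic_root_valring (p : {poly K}) x :
  p \is monic -> (forall i, p`_i \in valring v) -> root p x -> x \in valring v.
Proof.
move=> pm pv px; apply: contraT => xr.
have x0 : x != 0 by apply: contraNneq xr => ->; exact: rpred0.
have xm : x^-1 \in valmax v by rewrite valmaxE invrK xr orbT.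
have p0 : (0 < size p)%N by rewrite size_poly_gt0 monic_neq0.
have := px; rewrite /root horner_coef -(prednK p0) big_ord_recr /=.
have -> : p`_(size p).-1 = 1 by apply/eqP.
rewrite mul1r addrC addr_eq0 => /eqP e; case/negP: valmax1.
have xn0 : x ^+ (size p).-1 != 0 by rewrite expf_neq0.
rewrite -(divff xn0) {1}e mulNr valmaxN // mulr_suml; apply: valmax_sum => i _.
have il : (i < (size p).-1)%N by [].
rewrite -mulrA.
have -> : x ^+ i / x ^+ (size p).-1 = x^-1 * x^-1 ^+ ((size p).-1 - i.+1).
  rewrite -exprS subnSK // exprVn; apply: (mulIf xn0); rewrite divfK //.
  have xk0 : x ^+ ((size p).-1 - i) != 0 by rewrite expf_neq0.
  by apply: (mulfI xk0); rewrite mulVKf // -exprD subnK // ltnW.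
by rewrite mulrCA mulrC valmaxM // rpredM // rpredX // valmaxW.
Qed.

End ValuationRing.

Section Pullback.
Variables (C : comPzRingType) (K L : Cfield C) (f : {rmorphism K -> L}).
Hypothesis fC : forall c, f (Cmap K c) = Cmap L c.
Variable w : valuation L.

Fact pullback_eqoo x : w (f x) = None <-> x = 0.
Proof. by split=> [/v_eqoo/eqP|->]; [rewrite fmorph_eq0 => /eqP|rewrite rmorph0 v_0]. Qed.

Fact pullback_M x y : w (f (x * y)) = evadd (w (f x)) (w (f y)).
Proof. by rewrite rmorphM v_M. Qed.

Fact pullback_D x y : evle (evmin (w (f x)) (w (f y))) (w (f (x + y))).
Proof. by rewrite rmorphD v_D. Qed.

Fact pullback_C c : evle (Some 0) (w (f (Cmap K c))).
Proof. by rewrite fC v_C. Qed.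

(** The value group of [w] is kept as it is: a [valuation] need not be onto its group. *)
Definition pullback : valuation K :=
  Valuation (@vgroup_total _ _ w) (@vgroup_leD2r _ _ w)
    pullback_eqoo pullback_M pullback_D pullback_C.

End Pullback.

(** * The valuation attached to a valuation ring *)

Section ValuationOfRing.
Variables (C : comPzRingType) (K : Cfield C) (O : K -> Prop).

Record is_valring : Prop := IsValring {
  is_valringB : forall x y, O x -> O y -> O (x - y);
  is_valringM : forall x y, O x -> O y -> O (x * y);
  is_valring_total : forall x, O x \/ O x^-1;
  is_valringC : forall c, O (Cmap K c)
}.

Hypothesis OK : is_valring.

Let O1 : O 1. Proof. by rewrite -(rmorph1 (Cmap K)); apply: is_valringC. Qed.

Let unitK : Type := {x : K | x != 0}.

(** The value group is the group of nonzero elements modulo the units of [O], written additively,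
    with v(x) <= v(y) when y / x lies in [O]. *)
Definition value_equiv (x y : unitK) : bool :=
  `[< O (val x / val y) /\ O (val y / val x) >].

Let value_mulK (a c : K) (b : unitK) : O (a / val b) -> O (val b / c) -> O (a / c).
Proof.
move=> ab bc; have := is_valringM OK ab bc; rewrite mulrA divfK //; exact: (valP b).
Qed.

Fact value_equiv_refl : reflexive value_equiv.
Proof. by move=> x; apply/asboolP; rewrite divff //; exact: (valP x). Qed.

Fact value_equiv_sym : symmetric value_equiv.
Proof. by move=> x y; apply/asboolP/asboolP => -[]. Qed.

Fact value_equiv_trans : transitive value_equiv.
Proof.
move=> y x z /asboolP[xy yx] /asboolP[yz zy]; apply/asboolP.
by split; [exact: value_mulK xy yz|exact: value_mulK zy yx].
Qed.

Canonical value_equivRel :=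
  EquivRel value_equiv value_equiv_refl value_equiv_sym value_equiv_trans.

Definition value_group : Type := {eq_quot value_equivRel}.
HB.instance Definition _ := Choice.on value_group.
HB.instance Definition _ := EqQuotient.on value_group.

Definition unit_mul (x y : unitK) : unitK :=
  exist _ (val x * val y) (mulf_neq0 (valP x) (valP y)).
Definition unit_inv (x : unitK) : unitK :=
  exist _ (val x)^-1 (invr_neq0 (valP x)).
Definition unit_one : unitK := exist _ 1 (oner_neq0 K).

Definition value (x : unitK) : value_group := \pi_value_group x.
Definition value_add (g h : value_group) := value (unit_mul (repr g) (repr h)).
Definition value_opp (g : value_group) := value (unit_inv (repr g)).
Definition value_le (g h : value_group) : bool := `[< O (val (repr h) / val (repr g)) >].

Fact valueP x y : value x = value y <-> O (val x / val y) /\ O (val y / val x).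
Proof. by split=> [/eqmodP/asboolP|] // h; apply/eqmodP/asboolP. Qed.

Fact value_repr x : O (val (repr (value x)) / val x) /\ O (val x / val (repr (value x))).
Proof. by apply/valueP; rewrite {1}/value reprK. Qed.

Fact value_addE x y : value_add (value x) (value y) = value (unit_mul x y).
Proof.
have [[xa xb] [ya yb]] := (value_repr x, value_repr y).
rewrite /value_add valueP /unit_mul; split; cbn [val sval]; rewrite invfM mulrACA.
  exact: (is_valringM OK xa ya).
exact: (is_valringM OK xb yb).
Qed.

Fact value_oppE x : value_opp (value x) = value (unit_inv x).
Proof. by have [xa xb] := value_repr x; apply/valueP; rewrite /= !invrK; split; rewrite mulrC. Qed.

Fact value_leE x y : value_le (value x) (value y) <-> O (val y / val x).
Proof.
have [[xa xb] [ya yb]] := (value_repr x, value_repr y).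
split=> [/asboolP|] h; [|apply/asboolP].
  exact: (value_mulK yb (value_mulK h xa)).
exact: (value_mulK ya (value_mulK h xb)).
Qed.

Fact value_ind (P : value_group -> Prop) : (forall x, P (value x)) -> forall g, P g.
Proof. by move=> h g; rewrite -[g]reprK; apply: h. Qed.

Fact value_addA : associative value_add.
Proof.
elim/value_ind=> x; elim/value_ind=> y; elim/value_ind=> z.
by rewrite !value_addE; congr value; apply: val_inj; rewrite /= mulrA.
Qed.
Fact value_addC : commutative value_add.
Proof.
elim/value_ind=> x; elim/value_ind=> y.
by rewrite !value_addE; congr value; apply: val_inj; rewrite /= mulrC.
Qed.
Fact value_add0 : left_id (value unit_one) value_add.
Proof.
by elim/value_ind=> x; rewrite !value_addE; congr value; apply: val_inj; rewrite /= mul1r.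
Qed.
Fact value_addN : left_inverse (value unit_one) value_opp value_add.
Proof.
elim/value_ind=> x; rewrite value_oppE value_addE; congr value; apply: val_inj.
by rewrite /= mulVf //; apply: (valP x).
Qed.
HB.instance Definition _ :=
  GRing.isZmodule.Build value_group value_addA value_addC value_add0 value_addN.

Fact value_le_refl : reflexive value_le.
Proof. by elim/value_ind=> x; apply/value_leE; rewrite divff //; apply: (valP x). Qed.
Fact value_le_anti : antisymmetric value_le.
Proof.
elim/value_ind=> x; elim/value_ind=> y /andP[/value_leE a /value_leE b].
by apply/valueP.
Qed.
Fact value_le_trans : transitive value_le.
Proof.
elim/value_ind=> y; elim/value_ind=> x; elim/value_ind=> z /value_leE a /value_leE b.
by apply/value_leE; exact: value_mulK b a.
Qed.
HB.instance Definition _ := Order.Le_isPOrder.Build ring_display value_group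
  value_le_refl value_le_anti value_le_trans.

Definition value_porderZmod : porderZmodType := value_group.

Fact value_total : total (<=%R : rel value_porderZmod).
Proof.
elim/value_ind=> x; elim/value_ind=> y; apply/orP.
have [h|h] := is_valring_total OK (val y / val x); [left|right]; apply/value_leE => //.
by rewrite invf_div in h.
Qed.

Fact value_leD2r (c a b : value_porderZmod) : a <= b -> a + c <= b + c.
Proof.
elim/value_ind: a => x; elim/value_ind: b => y; elim/value_ind: c => z /value_leE h.
rewrite -[_ <= _]/(value_le (value_add (value x) (value z)) (value_add (value y) (value z))).
rewrite !value_addE; apply/value_leE; rewrite /= invfM mulrACA divff ?mulr1 //.
exact: (valP z).
Qed.

Definition value_fun (x : K) : option value_porderZmod := omap value (insub x).

Fact value_fun_eqoo x : value_fun x = None <-> x = 0.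
Proof.
rewrite /value_fun; case: insubP => [u u0 ux|] /=; last by rewrite negbK => /eqP.
by split=> // x0; case/eqP: u0.
Qed.

Fact value_funM x y : value_fun (x * y) = evadd (value_fun x) (value_fun y).
Proof.
rewrite /value_fun; case: (insubP _ x) => [u u0 ux|]; case: (insubP _ y) => [w w0 wy|] /=;
  rewrite ?negbK; try by move=> *; rewrite insubF //; apply/negbTE; rewrite mulf_eq0 negbK;
  apply/orP; auto.
rewrite insubT ?mulf_neq0 //= => h; congr Some.
rewrite -[_ + _]/(value_add (value u) (value w)) value_addE.
by congr value; apply: val_inj; rewrite /= ux wy.
Qed.

Fact value_funE x y : y != 0 -> evle (value_fun y) (value_fun x) <-> O (x / y).
Proof.
move=> y0; have O0 : O 0 by rewrite -(subrr 1); apply: is_valringB.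
rewrite /value_fun (insubT (fun z => z != 0) y0) /=; case: insubP => [u u0 ux|] /=.
  by rewrite -ux; exact: (value_leE (exist _ y y0)).
by rewrite negbK => /eqP ->; rewrite mul0r.
Qed.

Fact value_funD x y : evle (evmin (value_fun x) (value_fun y)) (value_fun (x + y)).
Proof.
have OD a b : O a -> O b -> O (a + b).
  by move=> Oa Ob; rewrite -[b]opprK; apply: is_valringB => //; rewrite -sub0r;
     apply: is_valringB => //; rewrite -(subrr 1); apply: is_valringB.
have [->|x0] := eqVneq x 0.
  by rewrite add0r; have /value_fun_eqoo -> := erefl (0 : K); case: (value_fun y) => //=.
have [->|y0] := eqVneq y 0.
  rewrite addr0; have /value_fun_eqoo -> := erefl (0 : K).
  by case: (value_fun x) => //= a; rewrite lexx.
rewrite /evmin; case: ifPn => h; apply/value_funE => //; rewrite mulrDl divff //; apply: OD => //.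
  exact/value_funE.
have [//|h'] := is_valring_total OK (x / y); case/negP: h.
by apply/value_funE => //; rewrite invf_div in h'.
Qed.

Fact value_fun_ge0 x : evle (Some 0) (value_fun x) <-> O x.
Proof.
suff -> : Some 0 = value_fun 1 by rewrite value_funE ?oner_eq0 // divr1.
by rewrite /value_fun insubT ?oner_eq0 //= => h; congr (Some (value _)); apply: val_inj.
Qed.

Fact value_funC c : evle (Some 0) (value_fun (Cmap K c)).
Proof. by apply/value_fun_ge0/is_valringC. Qed.

Definition valuation_of_ring : valuation K :=
  Valuation value_total value_leD2r value_fun_eqoo value_funM value_funD value_funC.

Lemma valring_of_ring x : x \in valring valuation_of_ring <-> O x.
Proof. by rewrite inE; apply: value_fun_ge0. Qed.

End ValuationOfRing.

(** * Ultraproducts *)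

Section ResidueRelation.
Variables (C : comPzRingType) (K : Cfield C) (v : valuation K).

(** This is the graph of the residue map, seen in [K] rather than in the dependent type
    [valring_type], so that reductions along several valuations compose without membership
    proofs. *)
Definition reduces_to (z : K) (x : residue v) : Prop :=
  exists zv : z \in valring v, x = res (ValringElt zv).

Lemma reduces_valring z x : reduces_to z x -> z \in valring v.
Proof. by case. Qed.

Lemma reduces_total z : z \in valring v -> exists x, reduces_to z x.
Proof. by move=> zv; exists (res (ValringElt zv)), zv. Qed.

Lemma reduces_surj x : exists z, reduces_to z x.
Proof.
rewrite -[x]reprK; case: (repr x) => z zv; exists z, zv.
by [].
Qed.

Lemma reduces_eq z x z' x' :
  reduces_to z x -> reduces_to z' x' -> x = x' <-> z - z' \in valmax v.
Proof.
case=> zv -> [zv' ->]; rewrite -[z - z']/(\val (ValringElt zv - ValringElt zv')).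
by rewrite -res_eq0 rmorphB subr_eq0; split=> /eqP.
Qed.

Lemma reducesD z x z' x' :
  reduces_to z x -> reduces_to z' x' -> reduces_to (z + z') (x + x').
Proof.
case=> zv -> [zv' ->]; exists (rpredD zv zv'); rewrite -rmorphD; congr res.
exact: val_inj.
Qed.

Lemma reducesM z x z' x' :
  reduces_to z x -> reduces_to z' x' -> reduces_to (z * z') (x * x').
Proof.
case=> zv -> [zv' ->]; exists (rpredM zv zv'); rewrite -rmorphM; congr res.
exact: val_inj.
Qed.

Lemma reducesN z x : reduces_to z x -> reduces_to (- z) (- x).
Proof.
case=> zv ->; exists (rpredNr zv); rewrite -rmorphN; congr res; exact: val_inj.
Qed.

Lemma reducesC c : reduces_to (Cmap K c) (Cmap (residue_Cfield v) c).
Proof. by exists (v_C v c). Qed.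

Lemma reduces0 z : reduces_to z 0 <-> z \in valmax v.
Proof.
split=> [[zv /esym/eqP]|zm]; first by rewrite res_eq0.
by exists (valmaxW zm); apply/esym/eqP; rewrite res_eq0.
Qed.

Lemma reduces1 : reduces_to 1 1.
Proof. by have := reducesC 1; rewrite !rmorph1. Qed.

Lemma reduces_fun z x x' : reduces_to z x -> reduces_to z x' -> x = x'.
Proof. by move=> zx zx'; apply/(reduces_eq zx zx'); rewrite subrr valmax0. Qed.

Lemma reducesB z x z' x' :
  reduces_to z x -> reduces_to z' x' -> reduces_to (z - z') (x - x').
Proof. by move=> zx /reducesN; apply: reducesD. Qed.

Lemma reducesV z x : reduces_to z x -> z \notin valmax v -> reduces_to z^-1 x^-1.
Proof.
move=> zx zm; have [y zy] := reduces_total (valring_inv zm).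
suff -> : x^-1 = y by [].
have z0 : z != 0 by apply: contraNneq zm => ->; exact: valmax0.
have := reducesM zx zy; rewrite divff // => h.
have xy := reduces_fun h reduces1.
have x0 : x != 0 by apply: contra_eqN xy => /eqP ->; rewrite mul0r eq_sym oner_eq0.
by apply: (mulfI x0); rewrite xy divff.
Qed.

End ResidueRelation.

(** * Ultrafilters and Los's theorem *)

Section Filters.
Variables (I : Type) (U : set_system I).
Hypothesis UF : UltraFilter U.
Implicit Types P Q : I -> Prop.

Lemma ultraS P Q : (forall i, P i -> Q i) -> U P -> U Q.
Proof. exact: filterS. Qed.

Lemma ultraS2 P1 P2 Q : (forall i, P1 i -> P2 i -> Q i) -> U P1 -> U P2 -> U Q.
Proof. exact: filterS2. Qed.

Lemma ultraT P : (forall i, P i) -> U P.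
Proof. by move=> h; apply: filterS filterT. Qed.

Lemma ultra_and P Q : U (fun i => P i /\ Q i) <-> U P /\ U Q.
Proof.
split=> [h|[p q]]; last exact: filterI.
by split; apply: ultraS h => i [].
Qed.

Lemma ultra_not P : U (fun i => ~ P i) <-> ~ U P.
Proof.
split=> [np p|np]; last by have [//|] := in_ultra_setVsetC P UF.
by have [i []] := filter_ex (filterI p np).
Qed.

Lemma ultra_or P Q : U (fun i => P i \/ Q i) <-> U P \/ U Q.
Proof.
split=> [h|[] h]; try by apply: ultraS h => i; auto.
have [p|/ultra_not p] := pselect (U P); [by left|right].
by apply: ultraS2 h p => i [].
Qed.

End Filters.

Lemma ultra_iff (I : Type) (U : set_system I) (UF : UltraFilter U) (P Q : I -> Prop) :
  (forall i, P i <-> Q i) -> U P <-> U Q.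
Proof. by move=> h; split; apply: (ultraS UF) => i /h. Qed.

(** Directedness makes the upper cones [le i] a base of a proper filter. An ultraproduct along the
    resulting ultrafilter inherits whatever holds for all sufficiently large indices. *)
Lemma directed_ultrafilter (I : Type) (le : I -> I -> Prop) (i0 : I) :
  (forall i, le i i) -> (forall i j k, le i j -> le j k -> le i k) ->
  (forall i j, exists k, le i k /\ le j k) ->
  exists U : set_system I, UltraFilter U /\ forall i, U (le i).
Proof.
move=> lexx letr ledir; pose B : set_system I := fun A => exists i, forall j, le i j -> A j.
have BF : ProperFilter B.
  split=> [[i h]|]; first exact: h (lexx i).
  split=> [|A A' [i h] [i' h']|A A' AA' [i h]]; first by exists i0.
    have [k [ik ik']] := ledir i i'; exists k => j kj.
    by split; [apply: h|apply: h']; apply: letr kj.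
  by exists i => j ij; apply/AA'/h.
have [U [UU BU]] := ultraFilterLemma BF; exists U; split=> // i.
by apply: BU; exists i.
Qed.

Lemma dependent_choice (I : Type) (T : I -> Type) (P : forall i, T i -> Prop) :
  (forall i, exists x, P i x) -> exists f : forall i, T i, forall i, P i (f i).
Proof. by move=> h; exists (fun i => sval (cid (h i))) => i; case: cid. Qed.

(** Witnesses are chosen for all indices at once, with 0 where there is none, as the quantifier
    steps of Los's theorem require. *)
Lemma pick_witness (I : Type) (T : I -> nmodType) (P : forall i, T i -> Prop) :
  exists f : forall i, T i, forall i, (exists x, P i x) -> P i (f i).
Proof.
apply: (dependent_choice (P := fun i y => (exists x, P i x) -> P i y)) => i.
by have [[x Px]|np] := pselect (exists x, P i x); [exists x|exists 0].
Qed.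

Section Los.
Variables (C : comPzRingType) (I : Type) (U : set_system I).
Hypothesis UF : UltraFilter U.
Variables (K : I -> Cfield C) (Q : Cfield C) (r : (forall i, K i) -> Q -> Prop).

(** It says that [Q] is a copy of the ultraproduct of the [K i], [r] relating a family to its class.
    A relation also covers the residue field of an ultraproduct, where a family of residues reaches
    its class only through lifts. *)
Record ultra_rel : Prop := UltraRel {
  ultra_rel_total : forall f, exists q, r f q;
  ultra_rel_surj : forall q, exists f, r f q;
  ultra_rel_eq : forall f g q q', r f q -> r g q' -> q = q' <-> U (fun i => f i = g i);
  ultra_relD : forall f g q q', r f q -> r g q' -> r (fun i => f i + g i) (q + q');
  ultra_relM : forall f g q q', r f q -> r g q' -> r (fun i => f i * g i) (q * q');
  ultra_relN : forall f q, r f q -> r (fun i => - f i) (- q);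
  ultra_relC : forall c, r (fun i => Cmap (K i) c) (Cmap Q c)
}.

Hypothesis rP : ultra_rel.

Lemma ultra_rel0 : r (fun=> 0) 0.
Proof.
have := ultra_relC rP 0; rewrite rmorph0.
by congr (r _ _); apply: functional_extensionality_dep => i; rewrite rmorph0.
Qed.

Lemma ultra_rel1 : r (fun=> 1) 1.
Proof.
have := ultra_relC rP 1; rewrite rmorph1.
by congr (r _ _); apply: functional_extensionality_dep => i; rewrite rmorph1.
Qed.

Lemma los_term (E : forall i, nat -> K i) (e : nat -> Q) (t : Lterm C) :
  (forall n, r (E^~ n) (e n)) -> r (fun i => term_eval (E i) t) (term_eval e t).
Proof.
move=> Ee; elim: t => [n|c|||t1 h1 t2 h2|t h|t1 h1 t2 h2] /=.
- exact: Ee.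
- exact: ultra_relC.
- exact: ultra_rel0.
- exact: ultra_rel1.
- exact: ultra_relD.
- exact: ultra_relN.
- exact: ultra_relM.
Qed.

Lemma los_update (E : forall i, nat -> K i) (e : nat -> Q) n f q :
  (forall m, r (E^~ m) (e m)) -> r f q ->
  forall m, r (fun i => update (E i) n (f i) m) (update e n q m).
Proof. by move=> Ee fq m; rewrite /update; case: (m == n). Qed.

Lemma los (phi : Lformula C) (E : forall i, nat -> K i) (e : nat -> Q) :
  (forall n, r (E^~ n) (e n)) -> holds e phi <-> U (fun i => holds (E i) phi).
Proof.
elim: phi E e => [t1 t2|g h|g1 h1 g2 h2|g1 h1 g2 h2|n g h|n g h] E e Ee /=.
- exact: (ultra_rel_eq rP (los_term _ Ee) (los_term _ Ee)).
- by rewrite (h E e Ee) ultra_not.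
- by rewrite (h1 E e Ee) (h2 E e Ee) ultra_and.
- by rewrite (h1 E e Ee) (h2 E e Ee) ultra_or.
- split=> [[q hq]|hU].
    have [f fq] := ultra_rel_surj rP q.
    by move: hq; rewrite (h _ _ (los_update n Ee fq)); apply: ultraS => i ?; exists (f i).
  have [f fP] := pick_witness (fun i x => holds (update (E i) n x) g).
  have [q fq] := ultra_rel_total rP f; exists q; rewrite (h _ _ (los_update n Ee fq)).
  exact: ultraS hU.
- split=> [hq|hU q]; last first.
    have [f fq] := ultra_rel_surj rP q; rewrite (h _ _ (los_update n Ee fq)).
    by apply: ultraS hU.
  (* The statement is tested on a family of counterexamples: where [f i] satisfies [g], every
     element does. *)
  have [f fP] := pick_witness (fun i x => ~ holds (update (E i) n x) g).
  have [q fq] := ultra_rel_total rP f.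
  have := hq q; rewrite (h _ _ (los_update n Ee fq)); apply: ultraS => i fi x.
  by apply: contrapT => nx; apply: (fP i) fi; exists x.
Qed.

Lemma ultra_models phi : models Q phi <-> U (fun i => models (K i) phi).
Proof. by apply: los => _; apply: ultra_rel0. Qed.

Lemma elementary_ultra (F : Cfield C -> Prop) :
  elementary_class F -> (forall i, F (K i)) -> F Q.
Proof.
case=> T [_ FT] FK; apply/FT => phi Tphi; apply/ultra_models/(ultraT UF) => i.
exact: (FT (K i)).1.
Qed.

End Los.

Section Transfer.
Variables (C : comPzRingType) (K Q : Cfield C) (r : K -> Q -> Prop).
Hypotheses (r_total : forall x, exists y, r x y) (r_surj : forall y, exists x, r x y)
  (r_eq : forall x y x' y', r x y -> r x' y' -> y = y' <-> x = x')
  (rD : forall x y x' y', r x y -> r x' y' -> r (x + x') (y + y'))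
  (rM : forall x y x' y', r x y -> r x' y' -> r (x * x') (y * y'))
  (rN : forall x y, r x y -> r (- x) (- y))
  (rC : forall c, r (Cmap K c) (Cmap Q c)).

(** An isomorphic copy is an ultraproduct over a one-point index set, so Los's theorem applies. *)
Lemma elementary_iso (F : Cfield C -> Prop) : elementary_class F -> F K -> F Q.
Proof.
move=> eF FK.
have UF := principal_filter_ultra tt.
have UE (P : unit -> Prop) : principal_filter tt P <-> P tt.
  by split=> [/principal_filterP|?] //; apply/principal_filterP.
apply: (@elementary_ultra _ unit _ UF (fun=> K) Q (fun f y => r (f tt) y) _ F) => //.
split=> [f|y|f g x y fx gy|*|*|*|*] /=; auto.
  by have [x xy] := r_surj y; exists (fun=> x).
by rewrite UE; apply: r_eq fx gy.
Qed.

End Transfer.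

(** * Ultraproducts of valued fields *)

Section Ultraproduct.
Variables (C : comPzRingType) (I : Type) (U : set_system I) (UF : UltraFilter U).
Variable K : I -> Cfield C.

(** The phantom argument makes 1 != 0 provable in the instances below: an ultrafilter is proper, so
    the index set is not empty. *)
Definition prod_ring (_ : UltraFilter U) : Type := forall i, K i.
Local Notation R := (prod_ring UF).
HB.instance Definition _ := gen_eqMixin R.
HB.instance Definition _ := gen_choiceMixin R.

Let ext (f g : R) : (forall i, f i = g i) -> f = g.
Proof. exact: functional_extensionality_dep. Qed.

Definition prod_add (f g : R) : R := fun i => f i + g i.
Definition prod_opp (f : R) : R := fun i => - f i.
Definition prod_mul (f g : R) : R := fun i => f i * g i.
Definition prod_const (c : C) : R := fun i => Cmap (K i) c.
Definition prod_zero : R := fun i => 0.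
Definition prod_one : R := fun i => 1.

Fact prod_addA : associative prod_add.
Proof. by move=> f g h; apply: ext => i; apply: addrA. Qed.
Fact prod_addC : commutative prod_add.
Proof. by move=> f g; apply: ext => i; apply: addrC. Qed.
Fact prod_add0 : left_id prod_zero prod_add.
Proof. by move=> f; apply: ext => i; apply: add0r. Qed.
Fact prod_addN : left_inverse prod_zero prod_opp prod_add.
Proof. by move=> f; apply: ext => i; apply: addNr. Qed.
HB.instance Definition _ :=
  GRing.isZmodule.Build R prod_addA prod_addC prod_add0 prod_addN.

Fact prod_mulA : associative prod_mul.
Proof. by move=> f g h; apply: ext => i; apply: mulrA. Qed.
Fact prod_mulC : commutative prod_mul.
Proof. by move=> f g; apply: ext => i; apply: mulrC. Qed.
Fact prod_mul1 : left_id prod_one prod_mul.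
Proof. by move=> f; apply: ext => i; apply: mul1r. Qed.
Fact prod_mulDl : left_distributive prod_mul prod_add.
Proof. by move=> f g h; apply: ext => i; apply: mulrDl. Qed.
Fact prod_one_neq0 : prod_one != 0.
Proof.
have [i _] := filter_ex (@filterT _ U _).
apply/eqP => /(congr1 (fun f : R => f i)) /eqP; exact/negP/oner_neq0.
Qed.
HB.instance Definition _ := GRing.Zmodule_isComNzRing.Build R
  prod_mulA prod_mulC prod_mul1 prod_mulDl prod_one_neq0.

Definition coord i (f : R) : K i := f i.
Fact coord_zmod_morphism i : zmod_morphism (coord i). Proof. by []. Qed.
Fact coord_monoid_morphism i : monoid_morphism (coord i). Proof. by []. Qed.
HB.instance Definition _ i :=
  GRing.isZmodMorphism.Build R (K i) (coord i) (coord_zmod_morphism i).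
HB.instance Definition _ i :=
  GRing.isMonoidMorphism.Build R (K i) (coord i) (coord_monoid_morphism i).

Definition null_ideal : {pred R} := [pred f | `[< U (fun i => coord i f = 0) >]].

Fact null_idealE f : f \in null_ideal <-> U (fun i => coord i f = 0).
Proof. by rewrite unfold_in; split=> /asboolP. Qed.

Fact null_ideal_closed : idealr_closed null_ideal.
Proof.
split=> [||a f g].
- by apply/null_idealE/(ultraT UF) => i; rewrite rmorph0.
- by apply/negP => /null_idealE /(filter_ex)[i /eqP]; apply/negP/oner_neq0.
- move=> /null_idealE f0 /null_idealE g0; apply/null_idealE; apply: (ultraS2 UF) f0 g0 => i.
  by move=> fi gi; rewrite -[LHS]/(a i * coord i f + coord i g) fi gi mulr0 addr0.
Qed.
HB.instance Definition _ := isIdealr.Build R null_ideal null_ideal_closed.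

Definition ultraproduct : Type := {ideal_quot null_ideal}.
HB.instance Definition _ := GRing.ComNzRing.on ultraproduct.
HB.instance Definition _ := EqQuotient.on ultraproduct.

Definition ucls (f : R) : ultraproduct := \pi_ultraproduct f.

Fact ucls_zmod_morphism : zmod_morphism ucls.
Proof. by move=> x y; rewrite /ucls !piE. Qed.
Fact ucls_monoid_morphism : monoid_morphism ucls.
Proof. by split=> [|x y]; rewrite /ucls !piE. Qed.
HB.instance Definition _ :=
  GRing.isZmodMorphism.Build R ultraproduct ucls ucls_zmod_morphism.
HB.instance Definition _ :=
  GRing.isMonoidMorphism.Build R ultraproduct ucls ucls_monoid_morphism.

Fact ucls_eq0 f : ucls f == 0 <-> U (fun i => f i = 0).
Proof. by rewrite /ucls piE Quotient.equivE subr0 null_idealE. Qed.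

Lemma ucls_eq f g : ucls f = ucls g <-> U (fun i => f i = g i).
Proof.
transitivity (U (fun i => (f - g) i = 0)).
  by rewrite -ucls_eq0 rmorphB subr_eq0; split=> /eqP.
apply: (ultra_iff UF) => i; rewrite -[(f - g) i]/(f i - g i).
by split=> [/eqP|->]; [rewrite subr_eq0 => /eqP|rewrite subrr].
Qed.

Lemma ucls_surj x : exists f, x = ucls f.
Proof. by exists (repr x); rewrite /ucls reprK. Qed.

Definition ultra_inv (x : ultraproduct) : ultraproduct :=
  ucls (fun i => (coord i (repr x))^-1).

Lemma ucls_inv f : ultra_inv (ucls f) = ucls (fun i => (f i)^-1).
Proof.
apply/ucls_eq; have : ucls (repr (ucls f)) = ucls f by rewrite {1}/ucls reprK.
by rewrite ucls_eq; apply: (ultraS UF) => i; rewrite /coord => ->.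
Qed.

Fact ultra_mulVf x : x != 0 -> ultra_inv x * x = 1.
Proof.
have [f ->] := ucls_surj x => f0.
rewrite ucls_inv -rmorphM -(rmorph1 ucls); apply/ucls_eq.
have : ~ U (fun i => f i = 0) by rewrite -ucls_eq0; exact/negP.
by rewrite -(ultra_not UF); apply: (ultraS UF) => i /eqP fi0; apply: mulVf.
Qed.

Fact ultra_inv0 : ultra_inv 0 = 0.
Proof.
rewrite -(rmorph0 ucls) ucls_inv; apply/ucls_eq/(ultraT UF) => i; exact: invr0.
Qed.

HB.instance Definition _ :=
  GRing.ComNzRing_isField.Build ultraproduct ultra_mulVf ultra_inv0.

Definition ultra_Cmap (c : C) : ultraproduct := ucls (prod_const c).

Fact ultra_Cmap_zmod_morphism : zmod_morphism ultra_Cmap.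
Proof.
move=> c d; rewrite /ultra_Cmap -rmorphB; congr ucls; apply: ext => i.
exact: rmorphB.
Qed.
Fact ultra_Cmap_monoid_morphism : monoid_morphism ultra_Cmap.
Proof.
split=> [|c d]; rewrite /ultra_Cmap -1?(rmorph1 ucls) -?rmorphM; congr ucls; apply: ext => i.
  exact: rmorph1.
exact: rmorphM.
Qed.
HB.instance Definition _ :=
  GRing.isZmodMorphism.Build C ultraproduct ultra_Cmap ultra_Cmap_zmod_morphism.
HB.instance Definition _ :=
  GRing.isMonoidMorphism.Build C ultraproduct ultra_Cmap ultra_Cmap_monoid_morphism.

Definition ultra_Cfield : Cfield C := @MkCfield C ultraproduct ultra_Cmap.

Lemma ultraproduct_rel : ultra_rel U (fun f (q : ultra_Cfield) => q = ucls f).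
Proof.
split=> //=.
- by move=> f; exists (ucls f).
- exact: ucls_surj.
- by move=> f g _ _ -> ->; apply: ucls_eq.
- by move=> f g _ _ -> ->; rewrite -rmorphD.
- by move=> f g _ _ -> ->; rewrite -rmorphM.
- by move=> f _ ->; rewrite -rmorphN.
Qed.

Variable v : forall i, valuation (K i).

Definition ultra_valring (x : ultra_Cfield) : Prop :=
  exists f, x = ucls f /\ U (fun i => f i \in valring (v i)).

Fact ultra_valringE f : ultra_valring (ucls f) <-> U (fun i => f i \in valring (v i)).
Proof.
split=> [[g [/ucls_eq fg]]|h]; last by exists f.
by apply: (ultraS2 UF) fg => i ->.
Qed.

Fact ultra_is_valring : is_valring ultra_valring.
Proof.
split.
- move=> _ _ [f [-> fO]] [g [-> gO]]; rewrite -rmorphB; apply/ultra_valringE.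
  by apply: (ultraS2 UF) fO gO => i; apply: rpredB.
- move=> _ _ [f [-> fO]] [g [-> gO]]; rewrite -rmorphM; apply/ultra_valringE.
  by apply: (ultraS2 UF) fO gO => i; apply: rpredM.
- move=> x; have [f ->] := ucls_surj x; rewrite -[(ucls f)^-1]/(ultra_inv (ucls f)).
  rewrite ucls_inv !ultra_valringE -(ultra_or UF); apply: (ultraT UF) => i.
  exact: valring_total.
- by move=> c; apply/ultra_valringE/(ultraT UF) => i; apply: valring_C.
Qed.

Definition ultra_val : valuation ultra_Cfield := valuation_of_ring ultra_is_valring.

Lemma ultra_val_ring f : ucls f \in valring ultra_val <-> U (fun i => f i \in valring (v i)).
Proof. by rewrite valring_of_ring ultra_valringE. Qed.

Lemma ultra_val_max f : ucls f \in valmax ultra_val <-> U (fun i => f i \in valmax (v i)).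
Proof.
have -> := valmaxE ultra_val (ucls f); rewrite -[(ucls f)^-1]/(ultra_inv (ucls f)) ucls_inv.
transitivity (U (fun i => f i = 0 \/ ~ ((f i)^-1 \in valring (v i)))).
  rewrite (ultra_or UF) (ultra_not UF) -ultra_val_ring -ucls_eq0.
  by split=> [/orP[->|/negP]|[->|/negP h]] //; [left|right|rewrite h orbT].
apply: (ultra_iff UF) => i; rewrite valmaxE.
by split=> [[->|/negP ->]|/orP[/eqP|/negP]]; rewrite ?eqxx ?orbT //; auto.
Qed.

(** A representative can be replaced by integral elements at the indices where it is not integral,
    which [U] ignores. Lifting and reduction then make sense at every index. *)
Lemma ultra_val_lift x :
  x \in valring ultra_val -> exists f, x = ucls f /\ forall i, f i \in valring (v i).
Proof.
have [f ->] := ucls_surj x => /ultra_val_ring fO.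
have [g gP] := pick_witness (fun i y => y \in valring (v i) /\ (f i \in valring (v i) -> y = f i)).
have gO i : g i \in valring (v i) /\ (f i \in valring (v i) -> g i = f i).
  apply: gP; case: (boolP (f i \in valring (v i))) => h; first by exists (f i).
  by exists 0; split=> //; apply: rpred0.
exists g; split; last by move=> i; case: (gO i).
by apply/ucls_eq; apply: (ultraS UF) fO => i; case: (gO i) => _ h /h.
Qed.

(** The polynomial and the approximate root are represented by families integral at every index.
    Hensel's lemma applies at each coordinate where the conditions on value and derivative hold,
    hence almost everywhere. *)
Lemma ultra_henselian : (forall i, henselian (v i)) -> henselian ultra_val.
Proof.
move=> hens p a pO aO pa pa'.
have [f [af fO]] := ultra_val_lift aO.
have [P Pp] : exists P : {poly R}, p = map_poly ucls P /\
    forall j i, (P`_j) i \in valring (v i).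
  have lift j : exists g, p`_j = ucls g /\ forall i, g i \in valring (v i).
    by apply: ultra_val_lift; apply: (polyOverP pO).
  have [g gP] := @choice _ _ _ lift.
  exists (\poly_(j < size p) g j); split=> [|j i].
    apply/polyP => j; rewrite coef_map coef_poly /=; case: ltnP => jp.
      by case: (gP j).
    by rewrite rmorph0 nth_default.
  rewrite coef_poly; case: ltnP => _; first by case: (gP j).
  exact: rpred0.
case: Pp => Pp PO; pose Pi i := map_poly (coord i) P.
have PiO i : Pi i \is a polyOver (valring (v i)).
  by apply/polyOverP => j; rewrite coef_map; apply: PO.
have Pf i : coord i (P.[f]) = (Pi i).[f i] by rewrite -horner_map.
have Pf' i : coord i (P^`().[f]) = (Pi i)^`().[f i] by rewrite deriv_map -horner_map.
have {pa} h1 : U (fun i => (Pi i).[f i] \in valmax (v i)).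
  move: pa; rewrite Pp af horner_map => /ultra_val_max.
  by apply: (ultraS UF) => i; rewrite -Pf.
have {pa'} h2 : U (fun i => ~ ((Pi i)^`().[f i] \in valmax (v i))).
  apply/(ultra_not UF) => h; case/negP: pa'; rewrite Pp af deriv_map horner_map.
  by apply/ultra_val_max; apply: (ultraS UF) h => i; rewrite -Pf'.
have [b bP] := pick_witness (fun i (b : K i) =>
   [/\ b \in valring (v i), root (Pi i) b & b - f i \in valmax (v i)]).
have {}bP : U (fun i => [/\ b i \in valring (v i), root (Pi i) (b i)
    & b i - f i \in valmax (v i)]).
  apply: (ultraS2 UF) h1 h2 => i h1 /negP h2; apply: bP.
  exact: hens (PiO i) (fO i) h1 h2.
exists (ucls b); split.
- by apply/ultra_val_ring; apply: (ultraS UF) bP => i [].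
- rewrite /root Pp horner_map; apply/ucls_eq0; apply: (ultraS UF) bP => i [_ /eqP + _].
  by rewrite -[P.[b] i]/(coord i P.[b]) -horner_map.
- rewrite af -rmorphB; apply/ultra_val_max.
  by apply: (ultraS UF) bP => i [].
Qed.

(** One integral family [g] is reduced both coordinatewise and in the ultraproduct. By Los's theorem
    the residue field of the ultraproduct therefore lies in an elementary class that contains all
    the residue fields. *)
Lemma ultra_residue : ultra_rel U (K := fun i => residue_Cfield (v i))
  (fun f (q : residue_Cfield ultra_val) => exists g : R,
     (forall i, reduces_to (g i) (f i)) /\ @reduces_to _ _ ultra_val (ucls g) q).
Proof.
split.
- move=> f.
  have [g gf] := dependent_choice (fun i => reduces_surj (f i)).
  have [|q gq] := @reduces_total _ _ ultra_val (ucls g).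
    by apply/ultra_val_ring/(ultraT UF) => i; apply: reduces_valring (gf i).
  by exists q, g.
- move=> q; have [z zq] := reduces_surj q.
  have [g [zg gO]] := ultra_val_lift (reduces_valring zq).
  have [f gf] := dependent_choice (fun i => reduces_total (gO i)).
  by exists f, g; rewrite -zg.
- move=> f f' q q' [g [gf gq]] [g' [gf' gq']].
  rewrite (reduces_eq gq gq') -rmorphB ultra_val_max; apply: (ultra_iff UF) => i.
  by rewrite (reduces_eq (gf i) (gf' i)).
- move=> f f' q q' [g [gf gq]] [g' [gf' gq']]; exists (g + g'); split=> [i|].
    exact: reducesD.
  by rewrite rmorphD; apply: reducesD.
- move=> f f' q q' [g [gf gq]] [g' [gf' gq']]; exists (g * g'); split=> [i|].
    exact: reducesM.
  by rewrite rmorphM; apply: reducesM.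
- move=> f q [g [gf gq]]; exists (- g); split=> [i|]; first exact: reducesN.
  by rewrite rmorphN; apply: reducesN.
- move=> c; exists (prod_const c); split=> [i|]; first exact: reducesC.
  exact: (@reducesC _ _ ultra_val).
Qed.

Lemma ultra_equichar : (forall i, equichar (v i)) -> equichar ultra_val.
Proof.
move=> eqc; apply/equicharP => p pp.
have -> : p%:R = ucls (fun i => p%:R).
  rewrite -(rmorph1 ucls) -raddfMn; congr ucls; apply: ext => i.
  by rewrite -[LHS]/(coord i (1 *+ p)) raddfMn.
move=> /ultra_val_max h; apply/eqP/ucls_eq0; apply: (ultraS UF) h => i.
exact: ((equicharP (v i)).1 (eqc i)).
Qed.

End Ultraproduct.

(** * Power series *)

(** Recursion on the polynomial yields the quadratic remainder without dividing by 2, hence in every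
    characteristic. *)
Lemma horner_taylor2 (R : comNzRingType) (p : {poly R}) (x h : R) :
  exists q, p.[x + h] = p.[x] + p^`().[x] * h + h ^+ 2 * q.
Proof.
elim/poly_ind: p => [|p c [q IH]]; first by exists 0; rewrite deriv0 !horner0; ring.
exists (q * (x + h) + p^`().[x]).
rewrite derivD derivC derivM derivX !hornerE IH; ring.
Qed.

Section PowerSeries.
Variable k : fieldType.

Definition series : Type := nat -> k.
HB.instance Definition _ := gen_eqMixin series.
HB.instance Definition _ := gen_choiceMixin series.
Implicit Types f g h : series.

Let ext f g : (forall i, f i = g i) -> f = g.
Proof. exact: functional_extensionality_dep. Qed.

Definition series_add f g : series := fun n => f n + g n.
Definition series_opp f : series := fun n => - f n.
Definition series_zero : series := fun=> 0.

Fact series_addA : associative series_add.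
Proof. by move=> f g h; apply: ext => i; apply: addrA. Qed.
Fact series_addC : commutative series_add.
Proof. by move=> f g; apply: ext => i; apply: addrC. Qed.
Fact series_add0 : left_id series_zero series_add.
Proof. by move=> f; apply: ext => i; apply: add0r. Qed.
Fact series_addN : left_inverse series_zero series_opp series_add.
Proof. by move=> f; apply: ext => i; apply: addNr. Qed.
HB.instance Definition _ :=
  GRing.isZmodule.Build series series_addA series_addC series_add0 series_addN.

Definition series_const (c : k) : series := fun n => if n == 0 then c else 0.
Definition series_mul f g : series := fun n => \sum_(i < n.+1) f i * g (n - i)%N.

(** A coefficient of a product involves finitely many coefficients of the factors, so commutativity
    and associativity are inherited from polynomials by truncation. *)
Definition truncate N f : {poly k} := \poly_(i < N) f i.

Fact series_mul_truncate N f g n :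
  (n < N)%N -> series_mul f g n = (truncate N f * truncate N g)`_n.
Proof.
move=> nN; rewrite coefM; apply: eq_bigr => i _; rewrite !coef_poly.
by rewrite !(leq_ltn_trans _ nN) ?leq_subr // -ltnS.
Qed.

Fact series_mulC : commutative series_mul.
Proof. by move=> f g; apply: ext => n; rewrite !(@series_mul_truncate n.+1) // mulrC. Qed.
Fact series_mulA : associative series_mul.
Proof.
move=> f g h; apply: ext => n; set T := truncate n.+1.
have le_n i : (n - i < n.+1)%N by rewrite ltnS leq_subr.
transitivity ((T f * (T g * T h))`_n); last rewrite mulrA.
  rewrite coefM; apply: eq_bigr => i _; rewrite (@series_mul_truncate n.+1) //.
  by rewrite [in RHS]coef_poly ltn_ord.
rewrite coefM; apply: eq_bigr => i _; rewrite (@series_mul_truncate n.+1) //.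
by rewrite [X in _ * X = _]coef_poly le_n.
Qed.
Fact series_mul1 : left_id (series_const 1) series_mul.
Proof.
move=> f; apply: ext => n; rewrite /series_mul big_ord_recl /= mul1r subn0.
by rewrite big1 ?addr0 // => i _; rewrite mul0r.
Qed.
Fact series_mulDl : left_distributive series_mul series_add.
Proof.
move=> f g h; apply: ext => n; rewrite /series_add /series_mul -big_split /=.
by apply: eq_bigr => i _; rewrite mulrDl.
Qed.
Fact series_one_neq0 : series_const 1 != 0.
Proof. by apply/eqP => /(congr1 (@^~ 0%N)) /eqP; apply/negP/oner_neq0. Qed.
HB.instance Definition _ := GRing.Zmodule_isComNzRing.Build series
  series_mulA series_mulC series_mul1 series_mulDl series_one_neq0.

Definition constant_coef f : k := f 0%N.
Fact constant_coef_zmod_morphism : zmod_morphism constant_coef. Proof. by []. Qed.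
Fact constant_coef_monoid_morphism : monoid_morphism constant_coef.
Proof. by split=> // f g; rewrite /constant_coef -[LHS]/(\sum_(i < 1) _) big_ord1. Qed.
HB.instance Definition _ := GRing.isZmodMorphism.Build series k
  constant_coef constant_coef_zmod_morphism.
HB.instance Definition _ := GRing.isMonoidMorphism.Build series k
  constant_coef constant_coef_monoid_morphism.

Lemma constant_coefM f g : (f * g) 0%N = f 0%N * g 0%N.
Proof. exact: (rmorphM constant_coef). Qed.

Fact series_const_zmod_morphism : zmod_morphism series_const.
Proof. by move=> x y; apply: ext => -[|n] //; apply/esym/subr0. Qed.
Fact series_const_monoid_morphism : monoid_morphism series_const.
Proof.
split=> // x y; apply: ext => n.
rewrite -[RHS]/(\sum_(i < n.+1) _) big_ord_recl /= subn0 big1 ?addr0; last first.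
  by move=> i _; rewrite mul0r.
by rewrite /series_const; case: (n == 0%N); rewrite ?mulr0.
Qed.
HB.instance Definition _ := GRing.isZmodMorphism.Build k series
  series_const series_const_zmod_morphism.
HB.instance Definition _ := GRing.isMonoidMorphism.Build k series
  series_const series_const_monoid_morphism.

Definition vanishes n f := forall i, (i < n)%N -> f i = 0.

Lemma vanishesD n f g : vanishes n f -> vanishes n g -> vanishes n (f + g).
Proof. by move=> hf hg i lin; rewrite -[LHS]/(f i + g i) hf // hg // addr0. Qed.

Lemma vanishesN n f : vanishes n f -> vanishes n (- f).
Proof. by move=> hf i lin; rewrite -[LHS]/(- f i) hf // oppr0. Qed.

Lemma vanishes_le m n f : (m <= n)%N -> vanishes n f -> vanishes m f.
Proof. by move=> lemn hf i lim; apply/hf/(leq_trans lim). Qed.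

Lemma vanishesM m n f g : vanishes m f -> vanishes n g -> vanishes (m + n) (f * g).
Proof.
move=> hf hg i lti; rewrite -[LHS]/(\sum_(j < i.+1) _) big1 // => j _.
case: (ltnP j m) => [/hf ->|lemj]; first by rewrite mul0r.
rewrite hg ?mulr0 // ltn_subLR -1?ltnS //.
by apply: leq_trans lti _; rewrite leq_add2r.
Qed.

Lemma vanishesMl n f g : vanishes n f -> vanishes n (f * g).
Proof. by move=> hf; rewrite -[n]addn0; apply: vanishesM. Qed.

Lemma lead_mul m n f g : vanishes m f -> vanishes n g -> (f * g) (m + n)%N = f m * g n.
Proof.
move=> hf hg; have lem : (m < (m + n).+1)%N by rewrite ltnS leq_addr.
rewrite -[LHS]/(\sum_(j < (m + n).+1) _) (bigD1 (Ordinal lem)) //= addKn big1 ?addr0 //.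
move=> j; rewrite -val_eqE /= neq_ltn => /orP[/hf ->|ltmj]; first by rewrite mul0r.
by rewrite hg ?mulr0 // ltn_subLR ?ltn_add2r // -ltnS.
Qed.

Lemma vanishes1 f : vanishes 1 f <-> f 0%N = 0.
Proof. by split=> [|h [|//]]; first exact. Qed.

(* Newton iteration, with the constant series [1 / p'(a)(0)] in place of [1 / p'(b)]. *)
Lemma series_hensel (p : {poly series}) (a : series) :
  p.[a] 0%N = 0 -> p^`().[a] 0%N != 0 ->
  exists b, p.[b] = 0 /\ vanishes 1 (b - a).
Proof.
move=> pa pa'; set c := series_const (p^`().[a] 0%N)^-1.
pose step b := b - p.[b] * c.
pose b_ n := iter n step a.
have ev q (x : series) : q.[x] 0%N = (map_poly constant_coef q).[x 0%N].
  by rewrite -[LHS]/(constant_coef q.[x]) -horner_map.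
have IH n : vanishes n.+1 p.[b_ n] /\ vanishes 1 (b_ n - a).
  elim: n => [|n [IHp IHa]].
    by split; [apply/vanishes1|rewrite subrr].
  have ba : b_ n 0%N = a 0%N.
    by apply/eqP; rewrite -subr_eq0; apply/eqP; have /vanishes1 := IHa.
  split=> /=; last first.
    rewrite /step addrAC; apply: vanishesD IHa _.
    by apply/vanishesN/vanishesMl; apply: vanishes_le IHp.
  rewrite -/(b_ n) /step.
  have [q ->] := horner_taylor2 p (b_ n) (- (p.[b_ n] * c)).
  set e := p.[b_ n] in IHp *; set d := p^`().[b_ n].
  (* As [b_ n] and [a] have the same constant coefficient, so have [d] and p'(a); hence 1 - d c has
     constant coefficient 0 and the product gains one order. *)
  have -> : e + d * - (e * c) = e * (1 - d * c) by ring.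
  apply: vanishesD.
    rewrite -[n.+2]addn1; apply: vanishesM IHp _; apply/vanishes1.
    rewrite -[LHS]/(constant_coef (1 - d * c)) rmorphB rmorphM rmorph1.
    rewrite -[LHS]/(1 - d 0%N * (p^`().[a] 0%N)^-1) /d [X in X / _]ev ba -ev.
    by rewrite divff ?subrr.
  apply/vanishesMl; rewrite sqrrN expr2; apply: (@vanishes_le _ (n.+1 + n.+1)).
    by rewrite addSn addnS !ltnS leq_addr.
  by apply: vanishesM; apply: vanishesMl.
(* Coefficient [i] is final from stage [i] on, since the correction at stage n is a multiple of
   p(b_n), which vanishes to order n + 1. The diagonal is the limit. *)
pose b : series := fun i => b_ i i.
have bb n : vanishes n.+1 (b - b_ n).
  move=> i; rewrite ltnS => lein.
  suff E : forall d, b_ (i + d)%N i = b_ i i by rewrite -(subnKC lein) -[LHS]/(b_ i i - _) E subrr.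
  elim=> [|d IHd]; first by rewrite addn0.
  rewrite addnS -IHd -[RHS]subr0; congr (_ - _).
  by apply: vanishesMl (IH _).1 _ _; rewrite ltnS leq_addr.
exists b; split; last first.
  rewrite -(subrK (b_ 0%N) b) -addrA; apply: vanishesD; first exact: bb.
  exact: (IH 0%N).2.
(* All three terms of the expansion at [b_ n] vanish to order n + 1, which settles coefficient
   [n]. *)
apply: ext => n; have [q] := horner_taylor2 p (b_ n) (b - b_ n).
rewrite addrC subrK => ->; set u := p^`().[b_ n].
have h := bb n; apply: (@vanishesD n.+1 _ _ _ _ n (ltnSn n)); last first.
  by rewrite expr2 -mulrA; apply: vanishesMl.
by apply: vanishesD (IH n).1 _; rewrite mulrC; apply: vanishesMl.
Qed.

(** The inverse is the Hensel root of the linear polynomial f X - 1 near the constant 1 / f(0). *)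
Lemma series_inv_exists f : f 0%N != 0 -> exists g, g * f = 1.
Proof.
move=> f0; have E (x : series) : (f *: 'X - 1%:P).[x] = f * x - 1 by rewrite !hornerE.
have [||g [g0 _]] := @series_hensel (f *: 'X - 1%:P) (series_const (f 0%N)^-1).
- rewrite E -[LHS]/(constant_coef _) rmorphB rmorphM rmorph1.
  by rewrite /constant_coef /= divff ?subrr.
- by rewrite derivB derivZ derivX derivC subr0 hornerZ hornerC mulr1.
- by exists g; apply/eqP; rewrite mulrC -subr_eq0 -E g0.
Qed.

Definition series_unit : pred series := fun f => f 0%N != 0.
Definition series_inv f : series :=
  if pselect (f 0%N != 0) is left h then sval (cid (series_inv_exists h)) else f.

Fact series_mulVr : {in series_unit, left_inverse 1 series_inv *%R}.
Proof. by move=> f f0; rewrite /series_inv; case: pselect => // h; case: cid. Qed.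
Fact series_unitP f g : g * f = 1 -> series_unit f.
Proof.
move=> fg; apply/negP => /eqP f0; have := constant_coefM g f.
by rewrite fg f0 mulr0 => /eqP; apply/negP/oner_neq0.
Qed.
Fact series_inv_out : {in [predC series_unit], series_inv =1 id}.
Proof. by move=> f f0; rewrite /series_inv; case: pselect => // h; case/negP: f0. Qed.
HB.instance Definition _ := GRing.ComNzRing_hasMulInverse.Build series
  series_mulVr series_unitP series_inv_out.

Lemma series_order f : f != 0 -> exists n, vanishes n f /\ f n != 0.
Proof.
move=> f0; have [n fn] : exists n, f n != 0.
  apply: contrapT => h; case/eqP: f0; apply: ext => n; apply/eqP.
  by apply: contraT => fn; case: h; exists n.
have [m fm mmin] := ex_minnP (ex_intro (fun n => f n != 0) n fn).
exists m; split=> // i; apply: contraTeq => /mmin; by rewrite -leqNgt.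
Qed.

Fact series_integral f g : f * g = 0 -> (f == 0) || (g == 0).
Proof.
move=> fg; apply/orP; have [|f0] := eqVneq f 0; [by left|right].
apply: contraT => g0.
have [[m [hm fm]] [n [hn gn]]] := (series_order f0, series_order g0).
by have := lead_mul hm hn; rewrite fg => /esym/eqP; rewrite mulf_eq0 (negPf fm) (negPf gn).
Qed.
HB.instance Definition _ := GRing.ComUnitRing_isIntegral.Build series series_integral.

Definition series_Xn m : series := fun n => if n == m then 1 else 0.

Lemma series_XnM m f i : (series_Xn m * f) i = if (i < m)%N then 0 else f (i - m)%N.
Proof.
rewrite -[LHS]/(\sum_(j < i.+1) series_Xn m j * f (i - j)%N); case: ltnP => im.
  rewrite big1 // => j _; rewrite /series_Xn ltn_eqF ?mul0r //.
  by apply: leq_ltn_trans im; rewrite -ltnS.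
rewrite (bigD1 (Ordinal (im : m < i.+1)%N)) //= big1 ?addr0; last first.
  by move=> j; rewrite -val_eqE /= /series_Xn => /negPf ->; rewrite mul0r.
by rewrite /series_Xn eqxx mul1r.
Qed.

Lemma vanishes_dvd m f : vanishes m f -> exists g, f = series_Xn m * g.
Proof.
move=> hf; exists (fun i => f (i + m)%N); apply: ext => i; rewrite series_XnM.
by case: ltnP => im; [apply: hf|rewrite subnK].
Qed.

Lemma series_Xn_neq0 m : series_Xn m != 0.
Proof.
apply/eqP => /(congr1 (fun f : series => f m)) /eqP.
by rewrite /series_Xn eqxx; apply/negP/oner_neq0.
Qed.

End PowerSeries.

(** * Laurent series with the t-adic valuation *)

Section Laurent.
Variables (C : comPzRingType) (k : Cfield C).

Definition laurent : Type := {fraction (series k)}.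
HB.instance Definition _ := GRing.Field.on laurent.

Definition of_series : {rmorphism series k -> laurent} := @tofrac (series k).

Definition laurent_Cfield : Cfield C :=
  @MkCfield C laurent (of_series \o @series_const k \o Cmap k).

Definition laurent_integer (x : laurent_Cfield) : Prop := exists f, x = of_series f.

Lemma of_series_inj : injective of_series.
Proof. by move=> f g /eqP; rewrite tofrac_eq => /eqP. Qed.

Lemma laurent_fracP (x : laurent) : exists f g, g != 0 /\ x = of_series f / of_series g.
Proof.
case: (repr x) (reprK x) => -[f g] /= g0 <-; exists f, g; split=> //.
apply: (mulIf (_ : of_series g != 0)); first by rewrite tofrac_eq0.
rewrite divfK ?tofrac_eq0 // /= [LHS]/GRing.mul /=; unlock FracField.tofrac.
rewrite -[LHS]FracField.pi_mul; apply/eqmodP => /=.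
rewrite FracField.equivfE /FracField.mulf /= !numden_Ratio ?mulf_neq0 ?oner_eq0 //.
by rewrite !mulr1 mulrC.
Qed.

(** Cancelling X^m leaves a denominator with nonzero constant coefficient, hence a unit. *)
Fact laurent_integer_div f g m n : (m <= n)%N -> g m != 0 -> vanishes m g -> vanishes n f ->
  laurent_integer (of_series f / of_series g).
Proof.
move=> lemn gm hg /(vanishes_le lemn) hf.
have [[f' ->] [g' gE]] := (vanishes_dvd hf, vanishes_dvd hg).
exists (f' / g'); rewrite gE !rmorphM -mulf_div divff ?mul1r.
  rewrite rmorphV //.
  by move: gm; rewrite gE series_XnM ltnn subnn.
by rewrite tofrac_eq0 series_Xn_neq0.
Qed.

Fact laurent_is_valring : is_valring laurent_integer.
Proof.
split=> [_ _ [f ->] [g ->]|_ _ [f ->] [g ->]|x|c].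
- by exists (f - g); rewrite rmorphB.
- by exists (f * g); rewrite rmorphM.
- have [f [g [g0 ->]]] := laurent_fracP x.
  have [->|f0] := eqVneq f 0; first by left; exists 0; rewrite rmorph0 mul0r.
  have [[n [hn fn]] [m [hm gm]]] := (series_order f0, series_order g0).
  case: (leqP m n) => [le|/ltnW le]; [left|right]; first exact: laurent_integer_div le _ _ _.
  by rewrite invf_div; apply: laurent_integer_div le _ _ _.
- by exists (series_const (Cmap k c)).
Qed.

Definition laurent_val : valuation laurent_Cfield := valuation_of_ring laurent_is_valring.

Lemma laurent_valring x : x \in valring laurent_val <-> laurent_integer x.
Proof. exact: valring_of_ring. Qed.

Lemma laurent_valmax f : (of_series f : laurent_Cfield) \in valmax laurent_val <-> f 0%N = 0.
Proof.
have -> := valmaxE laurent_val (of_series f); split=> [/orP[|]|f0].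
- by rewrite tofrac_eq0 => /eqP ->.
- move=> h; apply/eqP; apply: contraT => f0; case/negP: h; apply/laurent_valring.
  by exists f^-1; rewrite rmorphV.
- rewrite tofrac_eq0; case: eqVneq => //= fn0; apply/negP => /laurent_valring [g].
  move=> /(congr1 (fun x => x * of_series f)); rewrite mulVf ?tofrac_eq0 // -rmorphM.
  rewrite -(rmorph1 of_series) => /of_series_inj gf; have := constant_coefM g f.
  by rewrite -gf f0 mulr0 => /eqP; apply/negP/oner_neq0.
Qed.

Lemma laurent_henselian : henselian laurent_val.
Proof.
move=> p a pO /laurent_valring [f ->] pa pa'.
have [P Pp] : exists P : {poly series k}, p = map_poly of_series P.
  have [g gP] := @choice _ _ _ (fun j => (laurent_valring p`_j).1 (polyOverP pO j)).
  exists (\poly_(j < size p) g j); apply/polyP => j; rewrite coef_map coef_poly /=.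
  by case: ltnP => jp; [exact: gP|rewrite rmorph0 nth_default].
move: pa pa'; rewrite Pp deriv_map !horner_map => /laurent_valmax pa pa'.
have [|b [b0 ba]] := series_hensel pa.
  by apply: contraNneq pa' => ?; apply/laurent_valmax.
exists (of_series b); split.
- by apply/laurent_valring; exists b.
- by rewrite /root horner_map b0 rmorph0.
- by rewrite -rmorphB; apply/laurent_valmax/vanishes1.
Qed.

End Laurent.

(* The field is k((t)) with the t-adic valuation. *)
Lemma henselian_with_residue (C : comPzRingType) (k : Cfield C) :
  exists (B : Cfield C) (v : valuation B) (f : {rmorphism k -> B}),
    [/\ forall c, f (Cmap k c) = Cmap B c, henselian v, nontrivial_val v,
        forall x, f x \in valring v &
        forall z, z \in valring v -> exists x, z - f x \in valmax v].
Proof.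
exists (laurent_Cfield k), (laurent_val k), (of_series k \o @series_const k).
split=> //=.
- exact: laurent_henselian.
- apply/nontrivialP; exists (of_series k (series_Xn k 1))^-1.
  have := (laurent_valmax (series_Xn k 1)).2 erefl.
  have -> := valmaxE (laurent_val k) (of_series k (series_Xn k 1)).
  by rewrite tofrac_eq0 (negPf (series_Xn_neq0 _ _)).
- by move=> x; apply/laurent_valring; exists (series_const x).
- move=> _ /laurent_valring [g ->]; exists (g 0%N); rewrite -rmorphB.
  by apply/laurent_valmax; rewrite -[LHS]/(g 0%N - g 0%N) subrr.
Qed.

(** * Specialization into algebraically closed fields *)

Definition alg_closed (A : fieldType) : Prop :=
  forall p : {poly A}, (1 < size p)%N -> exists x, root p x.

Section Specialization.
Variables (R : comNzRingType) (B : fieldType) (e : {rmorphism R -> B}).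
Implicit Types (p q m : {poly R}).
Local Notation "p ^e" := (map_poly e p) (at level 2, format "p ^e").

(** Since [e] need not be injective, degrees are measured after applying [e]. Cutting a polynomial
    of least degree at that degree removes only coefficients killed by [e], and its leading
    coefficient then survives. *)
Lemma minimal_poly (T : {poly R} -> Prop) :
  (forall p q, p^e = q^e -> T p -> T q) -> (exists p, T p /\ p^e != 0) ->
  exists m, [/\ T m, e (lead_coef m) != 0 &
    forall p, T p -> p^e != 0 -> (size m <= size p^e)%N].
Proof.
move=> Te [p0 [Tp0 p00]].
pose N n := `[< exists p, [/\ T p, p^e != 0 & size p^e = n] >].
have exN : exists n, N n by exists (size p0^e); apply/asboolP; exists p0.
have [n /asboolP[p [Tp pe0 sp]] nmin] := ex_minnP exN.
have n0 : (0 < n)%N by rewrite -sp size_poly_gt0.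
have pn : e p`_n.-1 != 0 by move: pe0; rewrite -lead_coef_eq0 lead_coefE coef_map sp.
have pn0 : p`_n.-1 != 0 by apply: contraNneq pn => ->; rewrite rmorph0.
exists (\poly_(i < n) p`_i); split.
- apply: Te Tp; apply/polyP => i; rewrite !coef_map coef_poly.
  case: ltnP => // nltp; by rewrite raddf0 -coef_map nth_default ?sp.
- by rewrite lead_coef_poly.
- move=> q Tq q0; rewrite size_poly_eq //; apply: nmin; apply/asboolP; by exists q.
Qed.

Lemma pseudo_division m p : exists k q r,
  lead_coef m ^+ k *: p = q * m + r /\ (m != 0 -> (size r < size m)%N).
Proof.
exists (Pdiv.CommonRing.rscalp p m), (Pdiv.CommonRing.rdivp p m), (Pdiv.CommonRing.rmodp p m).
split; last by move=> m0; rewrite Pdiv.CommonRing.ltn_rmodp.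
exact: Pdiv.ComRing.rdivp_eq.
Qed.

Lemma map_poly_ker (A : fieldType) (phi : {rmorphism R -> A}) p :
  (forall x, e x = 0 -> phi x = 0) -> p^e = 0 -> map_poly phi p = 0.
Proof.
move=> eph pe0; apply/polyP => i; rewrite coef_map /= coef0 eph //.
by rewrite -coef_map pe0 coef0.
Qed.

Lemma size_map_lead p : e (lead_coef p) != 0 -> size p^e = size p.
Proof. by move=> h; apply: size_map_poly_id0. Qed.

(* A homomorphism from R extends to R[b] once it is nonzero at d: if b is transcendental over R, d is a
   nonzero coefficient of g; otherwise d is the leading coefficient of a minimal equation P of b times
   a constant in the ideal (g, P). *)
Lemma specialization_step (A : fieldType) (b : B) (g : {poly R}) :
  alg_closed A -> g^e.[b] != 0 ->
  exists d, e d != 0 /\ forall phi : {rmorphism R -> A},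
    (forall x, e x = 0 -> phi x = 0) -> phi d != 0 ->
    exists c : A, (forall q, q^e.[b] = 0 -> (map_poly phi q).[c] = 0) /\
                  (map_poly phi g).[c] != 0.
Proof.
move=> Aclosed gb.
have [alg|transc] := pselect (exists q, q^e.[b] = 0 /\ q^e != 0); last first.
  have ge0 : g^e != 0 by apply: contraNneq gb => ->; rewrite horner0.
  exists g`_(size g^e).-1; split.
    by rewrite -coef_map -lead_coefE lead_coef_eq0.
  move=> phi eph phid; set h := map_poly phi g.
  have h0 : h != 0 by apply: contraNneq phid => h0; rewrite -coef_map -/h h0 coef0.
  (* At a root [c] the product of h(c) and c is -1, so h(c) is nonzero. *)
  have [|c] := Aclosed (h * 'X + 1).
    by rewrite size_polyDl size_mulX // ?size_poly1 ltnS size_poly_gt0.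
  rewrite /root !hornerE => hc; exists c; split=> [q qb|]; last first.
    by apply: contraTneq hc => ->; rewrite mul0r add0r oner_eq0.
  rewrite (map_poly_ker eph) ?horner0 //.
  by apply/eqP; apply: contraT => qe0; case: transc; exists q.
have [|P [Pb eP Pmin]] := @minimal_poly (fun q => q^e.[b] = 0) _ alg.
  by move=> p q ->.
(* [S] is the ideal generated by [g], [P] and the polynomials killed by [e]. A member of least
   degree acts as a gcd of [g] and [P] up to denominators. *)
pose S p := exists s t z, p = s * g + t * P + z /\ z^e = 0.
have [||m [Sm em mmin]] := @minimal_poly S.
- move=> p q pq [s [t [z [pE ze]]]]; exists s, t, (z + (q - p)); split; first by rewrite pE; ring.
  by rewrite rmorphD rmorphB /= ze pq subrr addr0.
- exists P; split; last by rewrite -size_poly_gt0 (size_map_lead eP) size_poly_gt0;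
    apply: contraNneq eP => ->; rewrite lead_coef0 rmorph0.
  by exists 0, 1, 0; split; [ring|rewrite rmorph0].
have m0 : m != 0 by apply: contraNneq em => ->; rewrite lead_coef0 rmorph0.
have P0 : P != 0 by apply: contraNneq eP => ->; rewrite lead_coef0 rmorph0.
(* Pseudo-division by [m] leaves a remainder in [S] of smaller degree, which [e] must kill. *)
have divm p : S p -> exists k q, e (lead_coef m) ^+ k *: p^e = q^e * m^e.
  case=> s [t [z [pE ze]]]; have [k [q [r [E /(_ m0) rm]]]] := pseudo_division m p.
  exists k, q; have -> : q^e * m^e = (lead_coef m ^+ k *: p)^e - r^e.
    by rewrite E rmorphD rmorphM addrK.
  suff -> : r^e = 0 by rewrite subr0 map_polyZ rmorphXn.
  apply/eqP; apply: contraT => re0.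
  have Sr : S r.
    case: Sm => s' [t' [z' [mE ze']]]; set a := lead_coef m ^+ k in E.
    exists (a%:P * s - q * s'), (a%:P * t - q * t'), (a%:P * z - q * z'); split.
      have -> : r = a%:P * p - q * m by rewrite mul_polyC E addrAC subrr add0r.
      by rewrite pE [in q * m]mE; ring.
    by rewrite rmorphB !rmorphM /= ze ze' !mulr0 subrr.
  have := mmin r Sr re0; rewrite leqNgt (leq_ltn_trans _ rm) //.
  exact: size_poly.
have ek k : e (lead_coef m) ^+ k != 0 by rewrite expf_neq0.
have mb : m^e.[b] != 0.
  have [|k [q E]] := divm g; first by exists 1, 0, 0; split; [ring|rewrite rmorph0].
  apply: contraNneq gb => mb; have := congr1 (fun p : {poly B} => p.[b]) E.
  by rewrite hornerZ hornerM mb mulr0 => /eqP; rewrite mulf_eq0 (negPf (ek k)).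
(* After applying [e], P is q m up to a nonzero constant, and m(b) is nonzero, so q(b) = 0. By
   minimality of [P] the cofactor q has full degree, and m is constant. *)
have sm : size m = 1%N.
  have [|k [q E]] := divm P; first by exists 0, 1, 0; split; [ring|rewrite rmorph0].
  have Pe0 : P^e != 0 by rewrite -size_poly_gt0 (size_map_lead eP) size_poly_gt0.
  have kP0 : e (lead_coef m) ^+ k *: P^e != 0 by rewrite scaler_eq0 negb_or ek.
  have qe0 : q^e != 0 by apply: contraNneq kP0; rewrite E => ->; rewrite mul0r.
  have me0 : m^e != 0 by apply: contraNneq kP0; rewrite E => ->; rewrite mulr0.
  have qb : q^e.[b] = 0.
    have := congr1 (fun p : {poly B} => p.[b]) E; rewrite hornerZ hornerM Pb mulr0.
    by move=> /esym/eqP; rewrite mulf_eq0 (negPf mb) orbF => /eqP.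
  have := Pmin q qb qe0; rewrite -(size_map_lead eP) -(size_scale _ (ek k)) E.
  rewrite size_mul // (size_map_lead em).
  have : (0 < size q^e)%N by rewrite size_poly_gt0.
  have : (0 < size m)%N by rewrite size_poly_gt0.
  by case: (size m) => [|[|n]] // _ q0; rewrite addnS /= addnS ltnNge leq_addr.
have [d mE] : exists d, m = d%:P by exists m`_0; apply: size1_polyC; rewrite sm.
(* The first factor keeps the degree of [P] under [phi], which provides a root [c]; the second keeps
   the image of [g] from vanishing at [c], because d = s g + t P + z. *)
exists (lead_coef P * d); split.
  by rewrite rmorphM mulf_neq0 //; move: em; rewrite mE lead_coefC.
move=> phi eph; rewrite rmorphM mulf_eq0 negb_or => /andP[phiP phid].
have sP : size (map_poly phi P) = size P by apply: size_map_poly_id0.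
have [|c /eqP Pc] := Aclosed (map_poly phi P).
  rewrite sP ltnNge; apply/negP => /size1_polyC PC.
  case/eqP: (eP); move: Pb; rewrite PC map_polyC hornerC lead_coefC //.
exists c; split=> [q qb|].
  (* Every relation of [b] is a multiple of [P], up to a power of the leading coefficient and a
     remainder killed by [e]. *)
  have [k [s [r [E /(_ P0) rP]]]] := pseudo_division P q.
  have re0 : r^e = 0.
    apply/eqP; apply: contraT => re0.
    have rb : r^e.[b] = 0.
      have := congr1 (fun p => p^e.[b]) E.
      by rewrite map_polyZ hornerZ qb mulr0 rmorphD rmorphM /= !hornerE Pb mulr0 add0r.
    have := Pmin r rb re0; rewrite leqNgt (leq_ltn_trans _ rP) //.
    exact: size_poly.
  have := congr1 (fun p => (map_poly phi p).[c]) E.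
  rewrite map_polyZ hornerZ rmorphD rmorphM /= (map_poly_ker eph re0) addr0 hornerM Pc mulr0.
  by move=> /eqP; rewrite rmorphXn mulf_eq0 expf_eq0 (negPf phiP) andbF => /eqP.
case: Sm => s [t [z [E ze]]]; apply: contraNneq phid => gc.
have := congr1 (fun p => (map_poly phi p).[c]) E.
rewrite mE map_polyC hornerC !rmorphD !rmorphM /= (map_poly_ker eph ze) !hornerE gc Pc.
by rewrite !mulr0 !addr0 => ->.
Qed.

End Specialization.

(* The scalar ring is only pzRingType, whereas polynomials need 1 != 0. *)
Section NonzeroScalars.
Variable C : comPzRingType.
Definition nonzero_ring (_ : (1 : C) != 0) : Type := C.
Variable C1 : (1 : C) != 0.
HB.instance Definition _ := GRing.ComPzRing.on (nonzero_ring C1).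
HB.instance Definition _ := GRing.PzSemiRing_isNonZero.Build (nonzero_ring C1) C1.
Definition nonzero_ringType : comNzRingType := nonzero_ring C1.
End NonzeroScalars.

Section FiniteSpecialization.
Variables (C : comPzRingType) (A B : Cfield C).
Hypotheses (Aclosed : alg_closed A) (kerC : forall c, Cmap B c = 0 <-> Cmap A c = 0).

(** [R] is an iterated polynomial ring over [C], one variable for each element of [s], and [e] is
    evaluation. The prescribed [g] strengthens the induction: extending [phi] to a further element
    requires it to be nonzero at some [d]. *)
Lemma finite_specialization (s : seq B) :
  exists (R : comNzRingType) (e : {rmorphism R -> B}) (j : C -> R),
    [/\ forall c, e (j c) = Cmap B c, forall x, x \in s -> exists r, e r = x &
      forall g, e g != 0 -> exists phi : {rmorphism R -> A},
        [/\ forall c, phi (j c) = Cmap A c, forall x, e x = 0 -> phi x = 0 & phi g != 0]].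
Proof.
elim: s => [|b s [R [e [j [ej es hom]]]]].
  have C1 : (1 : C) != 0.
    apply/eqP => C10; have /eqP := oner_neq0 B.
    by rewrite -(rmorph1 (Cmap B)) C10 rmorph0.
  exists (nonzero_ringType C1), (Cmap B), id; split=> // g g0.
  exists (Cmap A); split=> // [x|]; first by move/kerC.
  by apply: contraNneq g0 => /kerC ->.
pose e' : {rmorphism {poly R} -> B} := horner_eval b \o map_poly e.
have e'E q : e' q = (map_poly e q).[b] by [].
exists {poly R}, e', (fun c => (j c)%:P); split=> [c|x|g g0].
- by rewrite e'E map_polyC hornerC /= ej.
- rewrite inE => /orP[/eqP ->|/es [r <-]]; last first.
    by exists r%:P; rewrite e'E map_polyC hornerC.
  by exists 'X; rewrite e'E map_polyX hornerX.
have [d [ed dP]] := specialization_step Aclosed g0.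
have [phi [phij phie phid]] := hom d ed.
have [c [cq cg]] := dP phi phie phid.
exists (horner_eval c \o map_poly phi); split=> //= x.
by rewrite /horner_eval map_polyC hornerC /= phij.
Qed.

(** As [phi] depends only on images under [e], a choice of lifts gives a function. It is defined on
    all of [B], so that the functions for growing [s] can be glued in an ultraproduct. *)
Lemma partial_hom (s : seq B) : exists f : B -> A,
  [/\ forall c, Cmap B c \in s -> f (Cmap B c) = Cmap A c,
    forall x y, x \in s -> y \in s -> x + y \in s -> f (x + y) = f x + f y &
    forall x y, x \in s -> y \in s -> x * y \in s -> f (x * y) = f x * f y].
Proof.
have [R [e [j [ej es hom]]]] := finite_specialization s.
have [|phi [phij phie _]] := hom 1; first by rewrite rmorph1 oner_neq0.
have phi_eq r r' : e r = e r' -> phi r = phi r'.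
  by move=> /eqP; rewrite -subr_eq0 -rmorphB => /eqP /phie /eqP; rewrite rmorphB subr_eq0 => /eqP.
have [l lP] : exists l : B -> R, forall x, x \in s -> e (l x) = x.
  apply: (@dependent_choice B (fun=> R) (fun x r => x \in s -> e r = x)) => x.
  have [/es[r rx]|nx] := pselect (x \in s); first by exists r.
  by exists 0.
exists (phi \o l); split=> [c cs|x y xs ys xys|x y xs ys xys] /=.
- by rewrite -phij; apply: phi_eq; rewrite ej lP.
- by rewrite -rmorphD; apply: phi_eq; rewrite rmorphD !lP.
- by rewrite -rmorphM; apply: phi_eq; rewrite rmorphM !lP.
Qed.

End FiniteSpecialization.

(** * Universal formulas and Prestel's criterion *)

Lemma rmorphism_of_fun (R S : pzRingType) (f : R -> S) :
  {morph f : x y / x + y} -> {morph f : x y / x * y} -> f 1 = 1 ->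
  exists g : {rmorphism R -> S}, g =1 f.
Proof.
move=> fD fM f1.
have fZ : zmod_morphism f by move=> x y; apply/eqP; rewrite eq_sym subr_eq -fD subrK.
pose zf := GRing.isZmodMorphism.Build R S f fZ.
pose mf := GRing.isMonoidMorphism.Build R S f (conj f1 fM).
pose g : {rmorphism R -> S} := HB.pack f zf mf.
by exists g.
Qed.

Section Formulas.
Variable C : comPzRingType.
Implicit Types (t : Lterm C) (g h phi : Lformula C).

Section Semantics.
Variable K : Cfield C.
Implicit Types e : nat -> K.

Lemma term_eval_fv e1 e2 t :
  (forall n, n \in term_fv t -> e1 n = e2 n) -> term_eval e1 t = term_eval e2 t.
Proof.
elim: t => [n|c|||t1 h1 t2 h2|t h|t1 h1 t2 h2] //= E; first by apply: E; rewrite inE.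
- by congr (_ + _); [apply: h1|apply: h2] => n nt; apply: E; rewrite mem_cat nt ?orbT.
- by rewrite h.
- by congr (_ * _); [apply: h1|apply: h2] => n nt; apply: E; rewrite mem_cat nt ?orbT.
Qed.

Lemma holds_fv e1 e2 g :
  (forall n, n \in formula_fv g -> e1 n = e2 n) -> holds e1 g <-> holds e2 g.
Proof.
elim: g e1 e2 => [t1 t2|g IH|g1 IH1 g2 IH2|g1 IH1 g2 IH2|i g IH|i g IH] e1 e2 /= E.
- by rewrite !(@term_eval_fv e1 e2) // => n nt; apply: E; rewrite mem_cat nt ?orbT.
- by rewrite (IH e1 e2).
- by rewrite (IH1 e1 e2) ?(IH2 e1 e2) // => n ng; apply: E; rewrite mem_cat ng ?orbT.
- by rewrite (IH1 e1 e2) ?(IH2 e1 e2) // => n ng; apply: E; rewrite mem_cat ng ?orbT.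
- suff E' x : holds (update e1 i x) g <-> holds (update e2 i x) g.
    by split=> -[x hx]; exists x; move: hx; rewrite E'.
  apply: IH => n ng; rewrite /update; case: eqVneq => // ni.
  by apply: E; rewrite mem_filter ni.
- suff E' x : holds (update e1 i x) g <-> holds (update e2 i x) g.
    by split=> h x; move: (h x); rewrite E'.
  apply: IH => n ng; rewrite /update; case: eqVneq => // ni.
  by apply: E; rewrite mem_filter ni.
Qed.

Lemma holds_foldr_forall e xs g :
  holds e (foldr (@LForall C) g xs) <->
  forall e', (forall n, n \notin xs -> e' n = e n) -> holds e' g.
Proof.
elim: xs e => [|x xs IH] e /=.
  split=> [hg e' E|]; last exact.
  by apply/(@holds_fv e' e) => // n _; apply: E.
split=> [hg e' E|hg a]; last first.
  apply/IH => e' E; apply: hg => n; rewrite inE negb_or => /andP[nx nxs].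
  by rewrite E // /update (negPf nx).
apply: ((IH _).1 (hg (e' x))) => n nxs; rewrite /update.
by case: eqVneq => [->//|nx]; apply: E; rewrite inE negb_or nx.
Qed.

(** For quantifier-free [g] this is the truth at [a] of a universal formula with matrix [g], so that
    matrices can stand for universal formulas in the criterion. *)
Definition holds_everywhere (a : K) g : Prop := forall e, e 0%N = a -> holds e g.

End Semantics.

Definition close g : Lformula C :=
  foldr (@LForall C) g [seq n <- formula_fv g | n != 0%N].

Lemma satisfies_close (K : Cfield C) (a : K) g :
  satisfies (close g) a <-> holds_everywhere a g.
Proof.
split=> [/holds_foldr_forall hg e e0|hg].
  pose xs := [seq n <- formula_fv g | n != 0%N].
  apply/(@holds_fv _ _ (fun n => if n \in xs then e n else a)).
    move=> n ng; rewrite mem_filter ng andbT; by case: eqVneq => [->|].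
  by apply: hg => n /negPf ->.
by apply/holds_foldr_forall => e E; apply: hg; apply: E; rewrite mem_filter.
Qed.

Lemma fv_foldr_forall xs g n :
  n \in formula_fv (foldr (@LForall C) g xs) -> n \in formula_fv g /\ n \notin xs.
Proof.
elim: xs => [|x xs IH] //=; rewrite mem_filter inE negb_or => /andP[nx /IH[ng nxs]].
by rewrite nx.
Qed.

Lemma universal_close g : quantifier_free g -> universal (close g).
Proof. by exists [seq n <- formula_fv g | n != 0%N], g. Qed.

Lemma unary_close g : unary_formula (close g).
Proof.
move=> n /fv_foldr_forall[ng]; rewrite mem_filter ng andbT negbK => /eqP ->.
by rewrite inE.
Qed.

Section Embedding.
Variables (K L : Cfield C) (f : {rmorphism K -> L}).
Hypothesis fC : forall c, f (Cmap K c) = Cmap L c.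

Lemma term_eval_embedding e t : term_eval (f \o e) t = f (term_eval e t).
Proof.
elim: t => [n|c|||t1 h1 t2 h2|t h|t1 h1 t2 h2] //=.
- by rewrite rmorph0.
- by rewrite rmorph1.
- by rewrite h1 h2 rmorphD.
- by rewrite h rmorphN.
- by rewrite h1 h2 rmorphM.
Qed.

Lemma holds_embedding e g : quantifier_free g -> holds (f \o e) g <-> holds e g.
Proof.
elim: g => //= [t1 t2 _|g IH /IH ->|g1 IH1 g2 IH2 /andP[/IH1 -> /IH2 ->]
  |g1 IH1 g2 IH2 /andP[/IH1 -> /IH2 ->]] //.
by rewrite !term_eval_embedding; split=> [/fmorph_inj|->].
Qed.

Lemma universal_substructure phi (a : K) :
  universal phi -> satisfies phi (f a) -> satisfies phi a.
Proof.
case=> xs [g [qg ->]] /holds_foldr_forall hg; apply/holds_foldr_forall => e E.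
by apply/(holds_embedding e qg); apply: hg => n /E /= ->.
Qed.

End Embedding.

Fixpoint rename_term (r : nat -> nat) t : Lterm C :=
  match t with
  | LVar n => LVar C (r n)
  | LAdd t1 t2 => LAdd (rename_term r t1) (rename_term r t2)
  | LOpp t1 => LOpp (rename_term r t1)
  | LMul t1 t2 => LMul (rename_term r t1) (rename_term r t2)
  | _ => t
  end.

(* Only meant for quantifier-free formulas: the quantifiers are left unchanged. *)
Fixpoint rename (r : nat -> nat) g : Lformula C :=
  match g with
  | LEqual t1 t2 => LEqual (rename_term r t1) (rename_term r t2)
  | LNot g1 => LNot (rename r g1)
  | LAnd g1 g2 => LAnd (rename r g1) (rename r g2)
  | LOr g1 g2 => LOr (rename r g1) (rename r g2)
  | _ => g
  end.

Lemma rename_quantifier_free r g : quantifier_free (rename r g) = quantifier_free g.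
Proof. by elim: g => //= g1 -> g2 ->. Qed.

Lemma term_eval_rename (K : Cfield C) r (e : nat -> K) t :
  term_eval e (rename_term r t) = term_eval (e \o r) t.
Proof. by elim: t => //= [t1 -> t2 ->|t ->|t1 -> t2 ->]. Qed.

Lemma holds_rename (K : Cfield C) r (e : nat -> K) g :
  quantifier_free g -> holds e (rename r g) <-> holds (e \o r) g.
Proof.
elim: g => //= [t1 t2 _|g IH /IH ->|g1 IH1 g2 IH2 /andP[/IH1 -> /IH2 ->]
  |g1 IH1 g2 IH2 /andP[/IH1 -> /IH2 ->]] //.
by rewrite !term_eval_rename.
Qed.

(* The variables of g and h other than the free variable 0 are kept apart, as even and odd. *)
Definition conjunction g h : Lformula C :=
  LAnd (rename double g) (rename (fun n => n.*2.-1) h).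

Lemma holds_everywhere_conjunction (K : Cfield C) (a : K) g h :
  quantifier_free g -> quantifier_free h ->
  holds_everywhere a (conjunction g h) <-> holds_everywhere a g /\ holds_everywhere a h.
Proof.
move=> qg qh; split=> [gh|[hg hh] e e0]; last first.
  by split; apply/holds_rename => //; [apply: hg|apply: hh].
split=> e e0.
  have [//|/(holds_rename _ _ qg) h1 _] := gh (fun n => if odd n then a else e n./2).
  by apply: (holds_fv _).1 h1 => n _ /=; rewrite odd_double doubleK.
have [//|_ /(holds_rename _ _ qh) h2] := gh (fun n => if odd n then e (uphalf n) else a).
by apply: (holds_fv _).1 h2 => -[|n] _ //=; rewrite odd_double /= doubleK.
Qed.

Definition big_and (gs : seq (Lformula C)) : Lformula C :=
  foldr (@LAnd C) (LEqual (LZero C) (LZero C)) gs.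

Lemma holds_big_and (K : Cfield C) (e : nat -> K) (T : eqType) (s : seq T) (G : T -> Lformula C) :
  holds e (big_and (map G s)) <-> forall x, x \in s -> holds e (G x).
Proof.
elim: s => [|y s IH] //=; split=> [[hy /IH hs] x|h].
  by rewrite inE => /orP[/eqP ->|/hs].
split; first by apply: h; rewrite inE eqxx.
by apply/IH => x xs; apply: h; rewrite inE xs orbT.
Qed.

Lemma big_and_quantifier_free (T : Type) (s : seq T) (G : T -> Lformula C) :
  (forall x, quantifier_free (G x)) -> quantifier_free (big_and (map G s)).
Proof. by move=> qG; elim: s => //= x s ->; rewrite qG. Qed.

End Formulas.

Section Criterion.
Variables (C : comPzRingType) (V : valued_class C).

Lemma forall_definable_embedding (K L : Cfield C) (v : valuation K) (w : valuation L)
    (f : {rmorphism K -> L}) (x : K) :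
  uniformly_forall_definable V -> V v -> V w ->
  (forall c, f (Cmap K c) = Cmap L c) -> f x \in valring w -> x \in valring v.
Proof.
case=> phi [uphi _ phiP] Vv Vw fC /(phiP _ _ Vw) fx; apply/(phiP _ _ Vv).
exact: universal_substructure fx.
Qed.

Hypothesis V_ultra : forall (I : Type) (U : set_system I) (UF : UltraFilter U)
  (K : I -> Cfield C) (v : forall i, valuation (K i)),
  (forall i, V (v i)) -> V (ultra_val UF v).

Hypothesis V_embedding : forall (K L : Cfield C) (v : valuation K) (w : valuation L)
  (f : {rmorphism K -> L}) (x : K), V v -> V w ->
  (forall c, f (Cmap K c) = Cmap L c) -> f x \in valring w -> x \in valring v.

Definition valid_formula (g : Lformula C) : Prop :=
  quantifier_free g /\
  forall (K : Cfield C) (v : valuation K), V v ->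
    forall a, a \in valring v -> holds_everywhere a g.

(** Otherwise the negation of a finite part of the diagram of [K] would be valid, hence true at [a],
    and the elements of [K] themselves refute it. Equations describe the diagram well enough, a ring
    morphism of fields being injective. *)
Lemma local_embedding (K : Cfield C) (a : K) (s : seq K) (cs : seq C) :
  (forall g, valid_formula g -> holds_everywhere a g) ->
  exists (L : Cfield C) (w : valuation L) (f : K -> L),
    [/\ V w, f a \in valring w,
      forall x y, x \in s -> y \in s -> f (x + y) = f x + f y,
      forall x y, x \in s -> y \in s -> f (x * y) = f x * f y &
      forall c, c \in cs -> f (Cmap K c) = Cmap L c].
Proof.
move=> aP; apply: contrapT => none.
pose ss := [seq (x, y) | x <- s, y <- s].
(* The position of an element in [l] serves as its variable; [a] comes first because variable 0 is
   the free one. *)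
pose l := a :: s ++ [seq z.1 + z.2 | z <- ss] ++ [seq z.1 * z.2 | z <- ss]
            ++ [seq Cmap K c | c <- cs].
pose var x : Lterm C := LVar C (index x l).
pose g1 z := LEqual (var (z.1 + z.2)) (LAdd (var z.1) (var z.2)).
pose g2 z := LEqual (var (z.1 * z.2)) (LMul (var z.1) (var z.2)).
pose g3 c := LEqual (var (Cmap K c)) (LConst c).
pose g := LAnd (big_and (map g1 ss)) (LAnd (big_and (map g2 ss)) (big_and (map g3 cs))).
have nth_l x : x \in l -> nth 0 l (index x l) = x by apply: nth_index.
have ls x : x \in s -> x \in l by move=> xs; rewrite inE mem_cat xs orbT.
have ssE z : z \in ss -> z.1 \in s /\ z.2 \in s by move=> /allpairsP[[x y] [xs ys ->]].
have valid : valid_formula (LNot g).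
  split=> [|L w Vw b bw e eb /= [/holds_big_and h1 [/holds_big_and h2 /holds_big_and h3]]].
    by rewrite /= !big_and_quantifier_free.
  apply: none; exists L, w, (fun x => e (index x l)); split=> //.
  - by rewrite /= eqxx eb.
  - by move=> x y xs ys; apply: (h1 (x, y)); apply: allpairs_f.
  - by move=> x y xs ys; apply: (h2 (x, y)); apply: allpairs_f.
have := aP _ valid (nth 0 l) erefl; apply => /=.
split; [|split]; apply/holds_big_and.
- move=> z zss; have [xs ys] := ssE z zss; rewrite /= !nth_l //; try exact: ls.
  by rewrite /l inE !mem_cat (map_f (fun z => z.1 + z.2)) ?orbT.
- move=> z zss; have [xs ys] := ssE z zss; rewrite /= !nth_l //; try exact: ls.
  by rewrite /l inE !mem_cat (map_f (fun z => z.1 * z.2)) ?orbT.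
- move=> c ccs; rewrite /= nth_l //.
  by rewrite /l inE !mem_cat (map_f (Cmap K)) ?orbT.
Qed.

(** An index is a finite part of [K] together with one of [C]. Any single identity is respected from
    some index on, hence by the ultraproduct of the local embeddings. *)
Lemma global_embedding (K : Cfield C) (a : K) :
  (forall g, valid_formula g -> holds_everywhere a g) ->
  exists (L : Cfield C) (w : valuation L) (f : {rmorphism K -> L}),
    [/\ V w, f a \in valring w & forall c, f (Cmap K c) = Cmap L c].
Proof.
move=> aP; pose I : Type := (seq K * seq C)%type.
pose le (i j : I) := {subset i.1 <= j.1} /\ {subset i.2 <= j.2}.
have [|||U [UF Ule]] := @directed_ultrafilter I le ([::], [::]).
- by move=> i; split.
- by move=> i j k [a1 a2] [b1 b2]; split=> x; [move/a1/b1|move/a2/b2].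
- move=> i j; exists (i.1 ++ j.1, i.2 ++ j.2); split; split=> x /=; rewrite mem_cat => ->;
  by rewrite ?orbT.
have [L /dependent_choice[w /dependent_choice[f fP]]] :=
  choice (fun i : I => local_embedding i.1 i.2 aP).
pose F (x : K) : ultra_Cfield UF L := @ucls _ _ _ UF L (fun i => f i x).
have memU (s : seq K) (cs : seq C) (P : I -> Prop) :
    (forall i, {subset s <= i.1} -> {subset cs <= i.2} -> P i) -> U P.
  by move=> h; apply: (ultraS UF) (Ule (s, cs)) => i [? ?]; apply: h.
have FD x y : F (x + y) = F x + F y.
  rewrite /F -rmorphD; apply/ucls_eq/(memU [:: x; y] [::]) => i si _.
  by case: (fP i) => _ _ -> //; apply: si; rewrite !inE eqxx ?orbT.
have FM x y : F (x * y) = F x * F y.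
  rewrite /F -rmorphM; apply/ucls_eq/(memU [:: x; y] [::]) => i si _.
  by case: (fP i) => _ _ _ -> //; apply: si; rewrite !inE eqxx ?orbT.
have FC c : F (Cmap K c) = Cmap (ultra_Cfield UF L) c.
  apply/ucls_eq/(memU [::] [:: c]) => i _ ci.
  by case: (fP i) => _ _ _ _ -> //; apply: ci; rewrite inE.
have [|Fr FrE] := rmorphism_of_fun FD FM; first by rewrite -(rmorph1 (Cmap K)) FC rmorph1.
exists (ultra_Cfield UF L), (ultra_val UF w), Fr; split=> [||c]; last by rewrite FrE.
- by apply: V_ultra => i; case: (fP i).
- by rewrite FrE; apply/ultra_val_ring/(ultraT UF) => i; case: (fP i).
Qed.

Lemma forall_definable_criterion : uniformly_forall_definable V.
Proof.
apply: contrapT => ndef; pose Phi : Type := {g | valid_formula g}.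
(* A valid formula holds on the valuation rings, so it can fail to define them only by holding at an
   element outside. *)
have bad (g : Phi) : exists (K : Cfield C) (v : valuation K) (a : K),
    [/\ V v, holds_everywhere a (sval g) & a \notin valring v].
  case: g => g [qg gV] /=; apply: contrapT => none; apply: ndef.
  exists (close g); split; [exact: universal_close|exact: unary_close|].
  move=> K v Vv a; rewrite satisfies_close; split=> [ga|av]; last exact: gV av.
  by apply: contraT => na; case: none; exists K, v, a.
(* Larger means stronger, with conjunctions as upper bounds. Each valid formula then holds at almost
   all of the bad elements, so their class [a'] satisfies all valid formulas. *)
pose le (g h : Phi) := forall (K : Cfield C) (a : K),
  holds_everywhere a (sval h) -> holds_everywhere a (sval g).
have top : valid_formula (LEqual (LZero C) (LZero C)) by [].
have [|||U [UF Ule]] := @directed_ultrafilter Phi le (exist _ _ top).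
- by move=> g K a.
- by move=> g h k gh hk K a /hk /gh.
- move=> [g [qg gV]] [h [qh hV]].
  have gh : valid_formula (conjunction g h).
    split=> [|K v Vv a av]; first by rewrite /= !rename_quantifier_free qg.
    by apply/holds_everywhere_conjunction => //; split; [apply: gV av|apply: hV av].
  by exists (exist _ _ gh); split=> K a /holds_everywhere_conjunction => /(_ qg qh) [].
have [K /dependent_choice[v /dependent_choice[a aP]]] := choice bad.
pose a' : ultra_Cfield UF K := @ucls _ _ _ UF K a.
have a'P g : valid_formula g -> holds_everywhere a' g.
  move=> gV e e0.
  have [E [E0 Ee]] : exists E : forall i, nat -> K i,
      (forall i, E i 0%N = a i) /\ forall n, e n = @ucls _ _ _ UF K (E^~ n).
    have [G GP] := choice (fun n => ucls_surj (e n)).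
    by exists (fun i n => if n is 0%N then a i else G n i); split=> // -[|n]; [exact: e0|exact: GP].
  apply/(los UF (ultraproduct_rel UF K) g Ee).
  apply: (ultraS UF) (Ule (exist _ g gV)) => i ig.
  by apply: ig (E0 i); case: (aP i).
have [L [w [f [Vw fa fC]]]] := global_embedding a'P.
have Vv : V (ultra_val UF v) by apply: V_ultra => i; case: (aP i).
have /ultra_val_ring := V_embedding Vv Vw fC fa.
apply/(ultra_not UF); apply: (ultraT UF) => i.
by case: (aP i) => _ _ /negP.
Qed.

End Criterion.

(** * Independent and comparable valuations *)

Section ReducePolynomials.
Variables (C : comPzRingType) (K : Cfield C) (u : valuation K).

Lemma reducesMn (z : K) (x : residue u) n : reduces_to z x -> reduces_to (z *+ n) (x *+ n).
Proof.
move=> zx; elim: n => [|n IH]; first by apply/reduces0/valmax0.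
by rewrite !mulrS; apply: reducesD.
Qed.

Lemma reduces_nat n : @reduces_to _ _ u n%:R n%:R.
Proof. exact/reducesMn/reduces1. Qed.

Lemma reducesX (z : K) (x : residue u) n : reduces_to z x -> reduces_to (z ^+ n) (x ^+ n).
Proof.
move=> zx; elim: n => [|n IH]; first exact: reduces1.
by rewrite !exprS; apply: reducesM.
Qed.

Lemma reduces_horner (g : {poly K}) (p : {poly residue u}) (z : K) (x : residue u) :
  (forall i, reduces_to g`_i p`_i) -> reduces_to z x -> reduces_to g.[z] p.[x].
Proof.
move=> gp zx; pose n := maxn (size g) (size p).
rewrite (@horner_coef_wide _ n g) ?leq_maxl // (@horner_coef_wide _ n p) ?leq_maxr //.
elim/big_ind2: _ => [|z1 x1 z2 x2|i _]; first exact: reduces_nat 0%N.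
  exact: reducesD.
by apply: reducesM => //; apply: reducesX.
Qed.

Lemma valmax_unit t : t \in valmax u -> 1 + t != 0 /\ (1 + t)^-1 \in valring u.
Proof.
move=> tm; have h : 1 + t \notin valmax u.
  by apply: contra (valmax1 u) => h; rewrite -(addrK t 1) valmaxB.
split; last exact: valring_inv.
by apply: contraNneq h => ->; apply: valmax0.
Qed.

End ReducePolynomials.

Section Independent.
Variables (C : comPzRingType) (K : Cfield C) (u v : valuation K) (a d : K).
Hypotheses (au : a \in valring u) (av : a \notin valring v)
  (dv : d \in valring v) (du : d \notin valring u).

(** The element z = a / d is small for [u] and has an inverse small for [v]. Dividing an element of
    both rings by 1 + z keeps its residue for [u] and makes it small for [v]. *)
Lemma approximation y : y \in valring u -> exists x, x - y \in valmax u /\ x \in valmax v.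
Proof.
have a0 : a != 0 by apply: contraNneq av => ->; apply: rpred0.
have d0 : d != 0 by apply: contraNneq du => ->; apply: rpred0.
pose z := a / d; have z0 : z != 0 by rewrite mulf_neq0 ?invr_neq0.
have zu : z \in valmax u by rewrite valmaxM // valmaxE invrK du orbT.
have zv : z^-1 \in valmax v by rewrite invf_div valmaxM // valmaxE invrK av orbT.
move=> yu; have [yv|yv] := boolP (y \in valring v).
  have [z1 z1u] := valmax_unit zu; have [z2 z2v] := valmax_unit zv.
  exists (y / (1 + z)); split.
    have -> : y / (1 + z) - y = (- y * (1 + z)^-1) * z by field.
    by rewrite valmaxM // rpredM // rpredN.
  have -> : y / (1 + z) = (y * (1 + z^-1)^-1) * z^-1 by field; rewrite z0 addrC z1.
  by rewrite valmaxM // rpredM.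
(* If [y] is not integral for [v], 1 + z is too weak a divisor; y / (1 + y z) behaves like z^-1 for
   [v]. *)
have y0 : y != 0 by apply: contraNneq yv => ->; apply: rpred0.
have yzu : y * z \in valmax u by rewrite valmaxM.
have yv' : y^-1 \in valmax v by rewrite valmaxE invrK yv orbT.
have yzv : y^-1 * z^-1 \in valmax v by rewrite valmaxM // valmaxW.
have [z1 z1u] := valmax_unit yzu; have [z2 z2v] := valmax_unit yzv.
exists (y / (1 + y * z)); split.
  have -> : y / (1 + y * z) - y = (- y * (1 + y * z)^-1) * (y * z) by field.
  by rewrite valmaxM // rpredM // rpredN.
have -> : y / (1 + y * z) = (1 + y^-1 * z^-1)^-1 * z^-1 by field; rewrite z0 y0 addrC z1.
by rewrite valmaxM.
Qed.

(* A monic polynomial over the residue field of u lifts to one which is congruent to X^(n-1) (X - 1)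
   for v, and so has a root by Hensel's lemma for v. *)
Lemma independent_residue_closed : henselian v -> alg_closed (residue u).
Proof.
move=> hens p0 sp0; pose p := (lead_coef p0)^-1 *: p0.
have lp0 : lead_coef p0 != 0 by rewrite lead_coef_eq0 -size_poly_gt0 ltnW.
suff [x xp] : exists x, root p x.
  by exists x; move: xp; rewrite /root hornerZ mulf_eq0 invr_eq0 (negPf lp0).
have pm : p \is monic by rewrite monicE lead_coefZ mulVf.
have sp : (1 < size p)%N by rewrite size_scale ?invr_eq0.
have [m spm] : exists m, size p = m.+2 by exists (size p).-2; case: (size p) sp => [|[]].
pose c (R : nzRingType) : {poly R} := ('X^(m.+1) - 'X^m)%R.
have cE (R : nzRingType) i : (c R)`_i = (i == m.+1)%:R - (i == m)%:R.
  by rewrite coefB !coefXn.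
pose q := p - c _.
(* The polynomials [p] and [c] are both monic of degree m + 1, so [q] has degree at most m and the
   lift [g] of [p] can be kept monic. *)
have sq i : (m < i)%N -> q`_i = 0.
  move=> mi; rewrite coefB (cE (residue u)) (gtn_eqF mi) subr0; case: eqVneq => [->|im].
    by have := monicP pm; rewrite lead_coefE spm => ->; rewrite subrr.
  by rewrite nth_default ?subr0 // spm ltn_neqAle eq_sym im.
have [h hP] : exists h : nat -> K, forall i, reduces_to (h i) q`_i /\ h i \in valmax v.
  apply: (@dependent_choice nat (fun=> K) (fun i z => reduces_to z q`_i /\ z \in valmax v)) => i.
  have [y yq] := reduces_surj q`_i; have [x [xy xv]] := approximation (reduces_valring yq).
  have xu : x \in valring u by rewrite -(subrK y x) rpredD ?(reduces_valring yq) // valmaxW.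
  have [t xt] := reduces_total xu; exists x; split=> //.
  by have := (reduces_eq xt yq).2 xy => <-.
pose H : {poly K} := \poly_(i < m.+1) h i; pose g := c _ + H.
have HE i : H`_i \in valmax v by rewrite coef_poly; case: ifP => _; [case: (hP i)|exact: valmax0].
have gp i : reduces_to g`_i p`_i.
  have -> : p = c _ + q by rewrite addrC subrK.
  rewrite /g (coefD (c K) H) (coefD (c (residue u)) q) (cE K) (cE (residue u)); apply: reducesD; first by apply: reducesB; apply: reduces_nat.
  rewrite coef_poly; case: ltnP => im; first by case: (hP i).
  by rewrite sq //; apply: reduces_nat 0%N.
have gm : g \is monic.
  have sc : size (c K) = m.+2.
    by rewrite size_polyDl ?size_polyN !size_polyXn.
  rewrite monicE lead_coefDl; last by rewrite sc ltnS size_poly.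
  by rewrite lead_coefE sc (cE K) eqxx gtn_eqF // subr0.
have one_v : 1 \in valring v by apply: valring1.
(* Modulo the maximal ideal of [v], [g] is X^(m+1) - X^m, which vanishes at 1 with derivative (m +
   1) - m = 1 in every characteristic. *)
have [|||b [bv rb _]] := hens g 1 _ one_v.
- apply/polyOverP => i; rewrite /g (coefD (c K) H) (cE K) rpredD ?(valmaxW (HE i)) //.
  by rewrite rpredB // rpred_nat.
- have c1 : (c K).[1] = 0 by rewrite hornerD hornerN !hornerXn !expr1n subrr.
  rewrite /g (hornerD (c K) H) c1 add0r.
  exact: horner_valmax.
- have c1 : (c K)^`().[1] = 1.
    rewrite derivB !derivXn hornerD hornerN !hornerMn !hornerXn !expr1n.
    by rewrite -mulrnBr // subSnn.
  rewrite /g (derivD (c K) H) hornerD c1; have Hv : H^`().[1] \in valmax v.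
    apply: horner_valmax => // i; rewrite coef_deriv.
    by rewrite -mulr_natl valmaxM // rpred_nat.
  by apply: contra (valmax1 v) => h1; rewrite -(addrK H^`().[1] 1) valmaxB.
have bu : b \in valring u.
  by apply: monic_root_valring gm _ rb => i; apply: reduces_valring (gp i).
have [x bx] := reduces_total bu; exists x.
have := reduces_horner gp bx; rewrite (eqP rb) => h0.
by apply/eqP; apply: reduces_fun h0 _; apply/reduces0/valmax0.
Qed.

End Independent.

(** * The valuation induced on the residue field of a coarser valuation *)

Section Quotient.
Variables (C : comPzRingType) (K : Cfield C) (u v : valuation K).
Hypothesis vu : forall x, x \in valring v -> x \in valring u.

Lemma coarser_valmax x : x \in valmax u -> x \in valmax v.
Proof.
rewrite !valmaxE => /orP[->//|xu]; apply/orP; right.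
by apply: contra xu; apply: vu.
Qed.

Definition quotient_valring (x : residue_Cfield u) : Prop :=
  exists z, z \in valring v /\ reduces_to z x.

Lemma quotient_valringE z (x : residue u) :
  reduces_to z x -> quotient_valring x <-> z \in valring v.
Proof.
move=> zx; split=> [[z' [z'v z'x]]|zv]; last by exists z.
rewrite -(subrK z' z) rpredD //; apply/valmaxW/coarser_valmax.
exact/(reduces_eq zx z'x).
Qed.

Fact quotient_is_valring : is_valring quotient_valring.
Proof.
split.
- move=> x y [z [zv zx]] [t [tv ty]]; exists (z - t); split; first exact: rpredB.
  exact: reducesB.
- move=> x y [z [zv zx]] [t [tv ty]]; exists (z * t); split; first exact: rpredM.
  exact: reducesM.
- move=> x; have [z zx] := reduces_surj x; have [zv|zv] := boolP (z \in valring v).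
    by left; exists z.
  right; exists z^-1; split; first by case: (valring_total v z) => // h; rewrite h in zv.
  apply: reducesV => //; apply: contra zv => /coarser_valmax; exact: valmaxW.
- by move=> c; exists (Cmap K c); split; [apply: valring_C|apply: reducesC].
Qed.

Definition quotient_val : valuation (residue_Cfield u) := valuation_of_ring quotient_is_valring.

Lemma quotient_val_ring z (x : residue_Cfield u) :
  reduces_to z x -> x \in valring quotient_val <-> z \in valring v.
Proof. by move=> zx; rewrite valring_of_ring (quotient_valringE zx). Qed.

Lemma quotient_val_max z (x : residue_Cfield u) :
  reduces_to z x -> x \in valmax quotient_val <-> z \in valmax v.
Proof.
move=> zx; have [zu|zu] := boolP (z \in valmax u).
  have -> : x = 0 by apply: reduces_fun zx _; apply/reduces0.
  by rewrite coarser_valmax //; split=> // _; apply: valmax0.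
have z0 : z != 0 by apply: contraNneq zu => ->; apply: valmax0.
have x0 : x != 0 by apply: contraNneq zu => x0; apply/reduces0; rewrite -x0.
rewrite !valmaxE (negPf z0) (negPf x0) /=.
have := quotient_val_ring (reducesV zx zu).
by split; apply: contraNN => /H.
Qed.

(** A [v]-integral lift of the data satisfies the same conditions by [quotient_val_max]. The root
    found in [K] is integral for [v], hence for [u], and can be reduced. *)
Lemma quotient_henselian : henselian v -> henselian quotient_val.
Proof.
move=> hens p x pO xO px px'.
have lift (y : residue_Cfield u) : y \in valring quotient_val ->
    exists z, z \in valring v /\ reduces_to z y.
  by have [z zy] := reduces_surj y => /(quotient_val_ring zy) zv; exists z.
have [a [av ax]] := lift x xO.
have [G GP] := choice (fun i => lift p`_i (polyOverP pO i)).
pose P := \poly_(i < size p) G i.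
have PO i : P`_i \in valring v.
  by rewrite coef_poly; case: ifP => _; [case: (GP i)|apply: rpred0].
have Pp i : reduces_to P`_i p`_i.
  rewrite coef_poly; case: ltnP => [_|/(nth_default 0) ->]; first by case: (GP i).
  exact: reduces_nat 0%N.
have Pp' i : reduces_to P^`()`_i p^`()`_i by rewrite !coef_deriv; apply: reducesMn.
have [||||b [bv rb ba]] := hens P a.
- exact/polyOverP.
- by [].
- exact/(quotient_val_max (reduces_horner Pp ax)).
- apply: contra px' => ?; exact/(quotient_val_max (reduces_horner Pp' ax)).
have [y yb] := reduces_total (vu bv); exists y; split.
- exact/(quotient_val_ring yb).
- apply/eqP; have := reduces_horner Pp yb; rewrite (eqP rb) => h0.
  by apply: reduces_fun h0 _; apply/reduces0/valmax0.
- exact/(quotient_val_max (reducesB yb ax)).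
Qed.

(** Reducing by [u] and then by the induced valuation amounts to reducing by [v]; the two residue
    fields are matched through a common lift [z] in [K]. *)
Lemma quotient_residue (F : Cfield C -> Prop) :
  elementary_class F -> F (residue_Cfield v) -> F (residue_Cfield quotient_val).
Proof.
move=> eF; apply: (@elementary_iso _ (residue_Cfield v) (residue_Cfield quotient_val) (fun x y => exists z t,
  [/\ @reduces_to _ _ v z x, @reduces_to _ _ u z t & @reduces_to _ _ quotient_val t y])) => //.
- move=> x; have [z zx] := reduces_surj x; have zv := reduces_valring zx.
  have [t zt] := reduces_total (vu zv).
  have [y ty] := reduces_total ((quotient_val_ring zt).2 zv).
  by exists y, z, t.
- move=> y; have [t ty] := reduces_surj y; have [z zt] := reduces_surj t.
  have [x zx] := reduces_total ((quotient_val_ring zt).1 (reduces_valring ty)).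
  by exists x, z, t.
- move=> x y x' y' [z [t [zx zt ty]]] [z' [t' [zx' zt' ty']]].
  rewrite (reduces_eq ty ty') (reduces_eq zx zx').
  exact: (quotient_val_max (reducesB zt zt')).
- move=> x y x' y' [z [t [zx zt ty]]] [z' [t' [zx' zt' ty']]].
  by exists (z + z'), (t + t'); split; apply: reducesD.
- move=> x y x' y' [z [t [zx zt ty]]] [z' [t' [zx' zt' ty']]].
  by exists (z * z'), (t * t'); split; apply: reducesM.
- move=> x y [z [t [zx zt ty]]].
  by exists (- z), (- t); split; apply: reducesN.
- move=> c; exists (Cmap K c), (Cmap (residue_Cfield u) c).
  by split; apply: reducesC.
Qed.

Lemma quotient_equichar : equichar v -> equichar quotient_val.
Proof.
move=> /equicharP eqv; apply/equicharP => p pp /(quotient_val_max (reduces_nat u p)) /(eqv p pp) p0.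
by have := reduces_nat u p; rewrite p0 => h; apply: reduces_fun h _; apply/reduces0/valmax0.
Qed.

End Quotient.

(** * Largeness *)

Section Image.
Variables (C : comPzRingType) (B L : Cfield C) (f : {rmorphism B -> L}).
Hypothesis fC : forall c, f (Cmap B c) = Cmap L c.

Definition image_pred : {pred L} := [pred y | `[< exists b, f b = y >]].

Lemma image_predP y : y \in image_pred <-> exists b, f b = y.
Proof. by rewrite unfold_in; split=> /asboolP. Qed.

Fact image_divring_closed : divring_closed image_pred.
Proof.
split=> [|x y|x y].
- by apply/image_predP; exists 1; rewrite rmorph1.
- move=> /image_predP[a <-] /image_predP[b <-].
  by apply/image_predP; exists (a - b); rewrite rmorphB.
- move=> /image_predP[a <-] /image_predP[b <-].
  by apply/image_predP; exists (a / b); rewrite fmorph_div.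
Qed.

Fact image_C c : Cmap L c \in image_pred.
Proof. by apply/image_predP; exists (Cmap B c). Qed.

Definition image_subfield : Csubfield L := MkCsubfield image_divring_closed image_C.

(** Largeness asks for a subfield of [F2], while the constructions embed a field into it. The
    valuation moves to the image by pullback along this inverse. *)
Lemma image_inverse : exists g : {rmorphism subfield_Cfield image_subfield -> B},
  (forall y, f (g y) = \val y) /\ forall b, exists y, g y = b.
Proof.
have [g gP] : exists g : subfield_Cfield image_subfield -> B, forall y, f (g y) = \val y.
  by apply: (@dependent_choice _ (fun=> B : Type) (fun y b => f b = \val y)) => -[y /= /image_predP].
have finj := fmorph_inj f.
have [|||g' g'E] := @rmorphism_of_fun _ _ g.
- by move=> x y; apply: finj; rewrite rmorphD !gP rmorphD.
- by move=> x y; apply: finj; rewrite rmorphM !gP rmorphM.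
- by apply: finj; rewrite gP !rmorph1.
exists g'; split=> [y|b]; first by rewrite g'E gP.
have fb : f b \in image_pred by apply/image_predP; exists b.
exists (SubfieldElt (E := image_subfield) fb).
by apply: finj; rewrite g'E gP.
Qed.

End Image.

Section PullbackIso.
Variables (C : comPzRingType) (K L : Cfield C) (f : {rmorphism K -> L}).
Hypotheses (fC : forall c, f (Cmap K c) = Cmap L c) (fS : forall y, exists x, f x = y).
Variable w : valuation L.

Lemma pullback_henselian : henselian w -> henselian (pullback fC w).
Proof.
move=> hens p a pO aO pa pa'.
have [||||b [bw rb ba]] := hens (map_poly f p) (f a).
- by apply/polyOverP => i; rewrite coef_map; apply: (polyOverP pO i).
- exact: aO.
- by rewrite horner_map.
- by rewrite deriv_map horner_map.
have [x xb] := fS b; exists x; split.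
- by rewrite -xb in bw.
- by move: rb; rewrite -xb fmorph_root.
- by move: ba; rewrite -xb -rmorphB.
Qed.

Lemma pullback_residue (F : Cfield C -> Prop) :
  elementary_class F -> F (residue_Cfield w) -> F (residue_Cfield (pullback fC w)).
Proof.
move=> eF; apply: (@elementary_iso _ (residue_Cfield w) (residue_Cfield (pullback fC w))
  (fun x y => exists z, @reduces_to _ _ w (f z) x /\ @reduces_to _ _ (pullback fC w) z y)) => //.
- move=> x; have [z zx] := reduces_surj x; have [t tz] := fS z.
  have [|y ty] := @reduces_total _ _ (pullback fC w) t.
    by have := reduces_valring zx; rewrite -tz.
  by exists y, t; rewrite tz.
- move=> y; have [z zy] := reduces_surj y.
  have [x zx] := reduces_total (reduces_valring zy : f z \in valring w).
  by exists x, z.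
- move=> x y x' y' [z [zx zy]] [z' [zx' zy']].
  by rewrite (reduces_eq zy zy') (reduces_eq zx zx') -rmorphB.
- move=> x y x' y' [z [zx zy]] [z' [zx' zy']]; exists (z + z').
  by rewrite rmorphD; split; apply: reducesD.
- move=> x y x' y' [z [zx zy]] [z' [zx' zy']]; exists (z * z').
  by rewrite rmorphM; split; apply: reducesM.
- by move=> x y [z [zx zy]]; exists (- z); rewrite rmorphN; split; apply: reducesN.
- by move=> c; exists (Cmap K c); rewrite fC; split; apply: reducesC.
Qed.

End PullbackIso.

Lemma pullback_equichar (C : comPzRingType) (K L : Cfield C) (f : {rmorphism K -> L})
    (fC : forall c, f (Cmap K c) = Cmap L c) (w : valuation L) :
  equichar w -> equichar (pullback fC w).
Proof.
move=> /equicharP eqw; apply/equicharP => p pp pm; apply: (fmorph_inj f).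
by rewrite rmorph_nat rmorph0; apply: eqw => //; rewrite -(rmorph_nat f).
Qed.

Section PullbackResidue.
Variables (C : comPzRingType) (K L : Cfield C) (f : {rmorphism K -> L}).
Hypothesis fC : forall c, f (Cmap K c) = Cmap L c.
Variable w : valuation L.
Local Notation u := (pullback fC w).

Lemma residue_embedding : exists j : {rmorphism residue_Cfield u -> residue_Cfield w},
  forall c, j (Cmap _ c) = Cmap _ c.
Proof.
have [j jP] : exists j : residue_Cfield u -> residue_Cfield w,
    forall x z, @reduces_to _ _ u z x -> @reduces_to _ _ w (f z) (j x).
  apply: (@dependent_choice _ (fun=> residue_Cfield w : Type) (fun x y => forall z, @reduces_to _ _ u z x -> @reduces_to _ _ w (f z) y)) => x.
  have [z zx] := reduces_surj x.
  have [y zy] := reduces_total (reduces_valring zx : f z \in valring w).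
  exists y => z' z'x; have [y' zy'] := reduces_total (reduces_valring z'x : f z' \in valring w).
  suff -> : y = y' by [].
  by apply/(reduces_eq zy zy'); rewrite -rmorphB; apply: (reduces_eq zx z'x).1.
have [|||g gE] := @rmorphism_of_fun _ _ j.
- move=> x y; have [[z zx] [t ty]] := (reduces_surj x, reduces_surj y).
  apply: reduces_fun (jP _ _ (reducesD zx ty)) _; rewrite rmorphD.
  exact: reducesD (jP _ _ zx) (jP _ _ ty).
- move=> x y; have [[z zx] [t ty]] := (reduces_surj x, reduces_surj y).
  apply: reduces_fun (jP _ _ (reducesM zx ty)) _; rewrite rmorphM.
  exact: reducesM (jP _ _ zx) (jP _ _ ty).
- by apply: reduces_fun (jP _ _ (reduces1 u)) _; rewrite rmorph1; apply: reduces1.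
exists g => c; rewrite gE; apply: reduces_fun (jP _ _ (reducesC u c)) _.
by rewrite fC; apply: reducesC.
Qed.

End PullbackResidue.

(** * Largeness against definability *)

Section Main.
Variables (C : comPzRingType) (F : Cfield C -> Prop).
Hypothesis eF : elementary_class F.

(* P = False and P = True give the two halves of the theorem. *)
Variable P : Prop.

Definition restricted_H : valued_class C := fun K v => H_class F v /\ (P -> equichar v).
Definition restricted_H' : valued_class C :=
  fun K v => restricted_H v /\ nontrivial_val v.

Definition restricted_large : Prop :=
  exists F1 F2 : Cfield C, [/\ F F1, F F2 &
    exists (E : Csubfield F2) (w : valuation (subfield_Cfield E)),
      [/\ nontrivial_val w, P -> equichar w, henselian w & Ciso (residue_Cfield w) F1]].

Lemma large_of_embedding (B F2 : Cfield C) (v : valuation B) (f : {rmorphism B -> F2}) :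
  (forall c, f (Cmap B c) = Cmap F2 c) -> nontrivial_val v -> (P -> equichar v) ->
  henselian v -> F (residue_Cfield v) -> F F2 -> restricted_large.
Proof.
move=> fC ntv eqv hens Fv FF2; have [g [gE gS]] := image_inverse fC.
have gC c : g (Cmap _ c) = Cmap B c by apply: (fmorph_inj f); rewrite gE fC.
(* The residue field of [w] itself is the first field, so the required isomorphism is the
   identity. *)
pose w := pullback gC v; exists (residue_Cfield w), F2; split=> //.
  exact: pullback_residue.
exists (image_subfield fC), w; split.
- case/nontrivialP: ntv => x xv; have [y yx] := gS x.
  by apply/nontrivialP; exists y; rewrite -yx in xv.
- by move=> /eqv; apply: pullback_equichar.
- exact: pullback_henselian.
- by exists idfun; split=> //; exists idfun.
Qed.

(** The valuation is trivial on the image of [k], which therefore maps isomorphically onto the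
    residue field. *)
Lemma power_series_residue (k B : Cfield C) (v : valuation B) (f : {rmorphism k -> B}) :
  (forall c, f (Cmap k c) = Cmap B c) -> (forall x, f x \in valring v) ->
  (forall z, z \in valring v -> exists x, z - f x \in valmax v) ->
  equichar v /\ (F k -> F (residue_Cfield v)).
Proof.
move=> fC fO fS.
have fm x : f x \in valmax v -> x = 0.
  rewrite valmaxE fmorph_eq0 => /orP[/eqP //|/negP[]].
  by rewrite -fmorphV.
split.
  apply/equicharP => p _; rewrite -(rmorph_nat f) => /fm ->; exact: rmorph0.
apply: (@elementary_iso _ k (residue_Cfield v) (fun x y => @reduces_to _ _ v (f x) y)) => //.
- by move=> x; apply: reduces_total.
- move=> y; have [z zy] := reduces_surj y; have [x zx] := fS _ (reduces_valring zy).
  have [y' xy'] := reduces_total (fO x); exists x.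
  by have -> : y = y' by apply/(reduces_eq zy xy').
- move=> x y x' y' xy xy'; rewrite (reduces_eq xy xy') -rmorphB.
  split=> [/fm/eqP|->]; first by rewrite subr_eq0 => /eqP.
  by rewrite subrr rmorph0 valmax0.
- by move=> x y x' y' xy xy'; rewrite rmorphD; apply: reducesD.
- by move=> x y x' y' xy xy'; rewrite rmorphM; apply: reducesM.
- by move=> x y xy; rewrite rmorphN; apply: reducesN.
- by move=> c; rewrite fC; apply: reducesC.
Qed.

(* The field F2((t)) is locally embeddable into A, hence embeds into an ultrapower of F2. *)
Lemma large_of_closed_subfield (A F2 : Cfield C) (j : {rmorphism A -> F2}) :
  alg_closed A -> (forall c, j (Cmap A c) = Cmap F2 c) -> F F2 -> restricted_large.
Proof.
move=> Aclosed jC FF2.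
have [B [v [f [fC hens ntv fO fS]]]] := henselian_with_residue F2.
have [eqv /(_ FF2) Fv] := power_series_residue fC fO fS.
(* Both kernels are that of [F2], into which [A] embeds and which embeds into [B]. *)
have kerC c : Cmap B c = 0 <-> Cmap A c = 0.
  rewrite -fC -(rmorph0 f); split=> [/fmorph_inj|c0]; last by rewrite -jC c0 !rmorph0.
  by rewrite -jC => /eqP; rewrite fmorph_eq0 => /eqP.
have [|||U [UF Ule]] := @directed_ultrafilter (seq B) (fun s t => {subset s <= t}) [::].
- by move=> s x.
- by move=> r s t rs st x /rs /st.
- by move=> s t; exists (s ++ t); split=> x; rewrite mem_cat => ->; rewrite ?orbT.
have [h hP] := choice (partial_hom Aclosed kerC).
pose Q := ultra_Cfield UF (fun=> F2).
pose H (b : B) : Q := @ucls _ _ _ UF (fun=> F2) (fun s => j (h s b)).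
have memU (s : seq B) (S : seq B -> Prop) : (forall t, {subset s <= t} -> S t) -> U S.
  by move=> sS; apply: (ultraS UF) (Ule s) => t; apply: sS.
have HC c : H (Cmap B c) = Cmap Q c.
  apply/ucls_eq/(memU [:: Cmap B c]) => t st; case: (hP t) => -> // *.
  by apply: st; rewrite mem_head.
have HD : {morph H : x y / x + y}.
  move=> x y; rewrite /H -rmorphD; apply/ucls_eq/(memU [:: x; y; x + y]) => t st.
  by case: (hP t) => _ -> // *; rewrite ?rmorphD //; apply: st; rewrite !inE eqxx ?orbT.
have HM : {morph H : x y / x * y}.
  move=> x y; rewrite /H -rmorphM; apply/ucls_eq/(memU [:: x; y; x * y]) => t st.
  by case: (hP t) => _ _ -> // *; rewrite ?rmorphM //; apply: st; rewrite !inE eqxx ?orbT.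
have [|g gE] := rmorphism_of_fun HD HM; first by rewrite -(rmorph1 (Cmap B)) HC rmorph1.
(* The second field is the ultrapower [Q], a member of [F] because [F2] is one. *)
apply: (@large_of_embedding B Q v g) => //; first by move=> c; rewrite gE.
exact: (elementary_ultra UF (ultraproduct_rel UF (fun=> F2)) eF).
Qed.

Lemma not_large_of_definable :
  uniformly_forall_definable restricted_H' -> ~ restricted_large.
Proof.
move=> def [F1 [F2 [FF1 FF2 [E [w [ntw eqw hens [iso [isobij isoC]]]]]]]].
have [B [v [f [fC hensv ntv fO fS]]]] := henselian_with_residue F2.
have [eqv /(_ FF2) Fv] := power_series_residue fC fO fS.
have Fw : F (residue_Cfield w).
  case: isobij => inv isoK invK.
  apply: (@elementary_iso _ F1 (residue_Cfield w) (fun x y => x = iso y)) => //.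
  - by move=> x; exists (inv x).
  - by move=> y; exists (iso y).
  - by move=> _ y _ y' -> ->; split=> [->|/fmorph_inj].
  - by move=> _ y _ y' -> ->; rewrite rmorphD.
  - by move=> _ y _ y' -> ->; rewrite rmorphM.
  - by move=> _ y ->; rewrite rmorphN.
case/nontrivialP: (ntw) => x /negP; apply.
pose g : {rmorphism subfield_Cfield E -> B} := f \o \val.
apply: (@forall_definable_embedding _ _ _ _ w v g x def).
- by split=> //; split=> //; split.
- by split=> //; split=> //; split.
- by move=> c; apply: fC.
- exact: fO.
Qed.

Lemma ultra_restricted_H (I : Type) (U : set_system I) (UF : UltraFilter U)
    (K : I -> Cfield C) (v : forall i, valuation (K i)) :
  (forall i, restricted_H (v i)) -> restricted_H (ultra_val UF v).
Proof.
move=> Hv; split; first split.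
- by apply: ultra_henselian => i; case: (Hv i) => -[].
- by apply: (elementary_ultra UF (ultra_residue UF v) eF) => i; case: (Hv i) => -[].
- by move=> p; apply: ultra_equichar => i; case: (Hv i) => _; apply.
Qed.

Lemma definable_of_not_large :
  ~ restricted_large -> uniformly_forall_definable restricted_H.
Proof.
move=> nlarge; apply: forall_definable_criterion => [|K L v w f a].
  exact: ultra_restricted_H.
move=> [[hensv Fv] eqv] [[hensw Fw] eqw] fC fa; apply: contraT => av; case: nlarge.
pose u := pullback fC w; have au : a \in valring u by [].
have [j jC] := residue_embedding fC w.
have [vu|] := pselect (forall x, x \in valring v -> x \in valring u).
  (* The induced valuation is nontrivial because the residue of [a] for [u] is not integral for
     it. *)
  apply: (@large_of_embedding _ _ (quotient_val vu) j) => //.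
  - have [x ax] := reduces_total au; apply/nontrivialP; exists x.
    by apply: contra av => /(quotient_val_ring vu ax).
  - by move=> /eqv; apply: quotient_equichar.
  - exact: quotient_henselian.
  - exact: quotient_residue.
move=> nvu; have [d dv du] : exists2 d, d \in valring v & d \notin valring u.
  apply: contrapT => none; apply: nvu => d dv.
  by apply: contraT => du; case: none; exists d.
apply: (@large_of_closed_subfield _ _ j) => //.
exact: (independent_residue_closed au av dv du).
Qed.

End Main.

Lemma uniformly_forall_definableS (C : comPzRingType) (V W : valued_class C) :
  (forall (K : Cfield C) (v : valuation K), V K v -> W K v) ->
  uniformly_forall_definable W -> uniformly_forall_definable V.
Proof. by move=> VW [phi [u1 u2 phiP]]; exists phi; split=> // K v /VW; apply: phiP. Qed.

Theorem theorem3p18 (C : comPzRingType) (F : Cfield C -> Prop)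
    (hF : elementary_class F) :
  ((uniformly_forall_definable (H'_class F) <->
      uniformly_forall_definable (H_class F)) /\
   (uniformly_forall_definable (H_class F) <-> ~ large F)) /\
  ((uniformly_forall_definable (He'_class F) <->
      uniformly_forall_definable (He_class F)) /\
   (uniformly_forall_definable (He_class F) <-> ~ equichar_large F)).
Proof.
have cycle (P1 P2 P3 : Prop) : (P1 -> P3) -> (P3 -> P2) -> (P2 -> P1) -> (P1 <-> P2) /\ (P2 <-> P3).
  by move=> *; split; split; auto.
(* Each half goes from (a) to (c) to (b) and back to (a); the last step only shrinks the class. *)
split; apply: cycle.
- move=> def [F1 [F2 [FF1 FF2 [E [w [ntw hens iso]]]]]].
  apply: (@not_large_of_definable _ _ hF False).
    by apply: uniformly_forall_definableS def => K v [[Hv _] ntv].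
  by exists F1, F2; split=> //; exists E, w.
- move=> nlarge; have [|phi [uphi phi1 phiP]] := @definable_of_not_large _ _ hF False.
    move=> [F1 [F2 [FF1 FF2 [E [w [ntw _ hens iso]]]]]]; apply: nlarge.
    by exists F1, F2; split=> //; exists E, w.
  by exists phi; split=> // K v Hv; apply: phiP.
- by apply: uniformly_forall_definableS => K v [].
- move=> def [F1 [F2 [FF1 FF2 [E [w [ntw eqw hens iso]]]]]].
  apply: (@not_large_of_definable _ _ hF True).
    by apply: uniformly_forall_definableS def => K v [[Hv /(_ Logic.I) eqv] ntv].
  by exists F1, F2; split=> //; exists E, w.
- move=> nlarge; have [|phi [uphi phi1 phiP]] := @definable_of_not_large _ _ hF True.
    move=> [F1 [F2 [FF1 FF2 [E [w [ntw eqw hens iso]]]]]]; apply: nlarge.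
    by exists F1, F2; split=> //; exists E, w; split=> //; apply: eqw.
  by exists phi; split=> // K v [Hv eqv]; apply: phiP.
- by apply: uniformly_forall_definableS => K v [[Hv _] eqv].
Qed.
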